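(* Let $(X,J)$ be a killed Markov additive process with finite phase space $E$ (irreducible phase process, killing rate vector $\boldsymbol q\neq\boldsymbol 0$). Let $\underline X$ be its overall infimum and $\underline G$ the (last) time of the infimum. Then, under each law $\mathbb P_k$, $k\in E$: (i) On the event $\{X_{\underline G}=\underline X\}$ the process splits at $\underline G$: given $J_{\underline G}$ (i.e. conditionally on $\{X_{\underline G}=\underline X,\ J_{\underline G}=j\}$ for every $j$ for which this event has positive probability) the processes $(X_t,J_t)_{t\in[0,\underline G]}$ and $(X_{\underline G+t}-\underline X,\,J_{\underline G+t})_{t\ge 0}$ are independent. (ii) On the event $\{X_{\underline G}>\underline X\}$ the process splits at $\underline G-$: given $J_{\underline G-}$ (i.e. conditionally on $\{X_{\underline G}>\underline X,\ J_{\underline G-}=j\}$ for every $j$ for which this event has positive probability) the processes $(X_t,J_t)_{t\in[0,\underline G)}$ and $(X_{\underline G+t}-\underline X,\,J_{\underline G+t})_{t\ge 0}$ are independent.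
   Context: Killed Markov additive process (MAP). $E$ is a finite set of phases. $(X_t,J_t)_{t\ge 0}$ is càdlàg with values in $\mathbb R\times E$ up to its life time $\zeta:=\inf\{t\ge 0: J_t=\dagger\}$, after which it stays in the absorbing state $(\infty,\dagger)$, $\dagger\notin E$. For all $T\ge 0$, given $\{J_T=i\}$ with $i\in E$, the process $(X_{T+t}-X_T,J_{T+t})_{t\ge0}$ is independent of $(X_t,J_t)_{t\in[0,T]}$ and has the law of $(X,J)$ given $\{J_0=i\}$. Equivalently: $J$ is a (possibly transient) continuous-time Markov chain on $E$, assumed irreducible, killed (sent to $\dagger$) at rate $q_i$ in phase $i$; $X$ evolves as a Lévy process $X^i$ while $J=i$, and has an additional jump distributed as a random variable $U_{ij}$ when $J$ switches from $i$ to $j\neq i$; all these components are independent. $\mathbb P_i$ denotes the law with $X_0=0,\ J_0=i$. Standing assumption: the vector of killing rates $\boldsymbol q=(q_i)_{i\in E}$ is not the zero vector, so $\zeta<\infty$ a.s. Infimum: $\underline X=\inf_{t\in[0,\zeta)}X_t$ and $\underline G=\sup\{t\in[0,\zeta]: X_t\wedge X_{t-}=\underline X\}$, with the conventions $X_\zeta=\infty$, $X_{0-}=X_0$, $J_{0-}=J_0$. *)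

(* Defs.v *)
From mathcomp Require Import all_boot all_order all_algebra.
From mathcomp Require Import all_classical all_reals all_analysis measurable_realfun.

Set Implicit Arguments.
Unset Strict Implicit.
Unset Printing Implicit Defensive.

Import Order.TTheory GRing.Theory Num.Theory.
Import numFieldNormedType.Exports.

Local Open Scope classical_set_scope.
Local Open Scope ring_scope.

(* A path of (X, J) is a pair x : R -> \bar R, y : R -> option E. Only the times
   t >= 0 matter, None is the cemetery phase and (+oo, None) the absorbing
   state. *)

Definition lifetime (R : realType) (E : finType) (y : R -> option E) : \bar R :=
  ereal_inf [set t%:E | t in [set t : R | 0 <= t /\ y t = None]].

Definition left_value (R : realType) (x : R -> \bar R) (t : R) : \bar R :=
  if t == 0 then x 0 else lim (x s @[s --> t^'-]).

(* The left limit of a path with values in a discrete space is its eventual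
   value. *)
Definition left_phase (R : realType) (E : finType) (y : R -> option E) (t : R) :
    option E :=
  if t == 0 then y 0 else xget None [set j | \forall s \near t^'-, y s = j].

Definition overall_inf (R : realType) (E : finType) (x : R -> \bar R)
    (y : R -> option E) : \bar R :=
  ereal_inf [set x t | t in [set t : R | 0 <= t /\ (t%:E < lifetime y)%E]].

(* The supremum is taken in R. It is a genuine one when the lifetime is finite,
   which holds almost surely for the processes considered here. *)
Definition inf_time (R : realType) (E : finType) (x : R -> \bar R)
    (y : R -> option E) : R :=
  sup [set t : R | [/\ 0 <= t, (t%:E <= lifetime y)%E &
                       mine (x t) (left_value x t) = overall_inf x y]].

Record killed_cadlag (R : realType) (E : finType) (x : R -> \bar R)
    (y : R -> option E) : Prop := KilledCadlag {
  kc_fin : forall t : R, 0 <= t -> (t%:E < lifetime y)%E -> x t \is a fin_num;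
  kc_dead : forall t : R, 0 <= t -> (lifetime y <= t%:E)%E ->
    x t = +oo%E /\ y t = None;
  kc_right : forall t : R, 0 <= t -> (t%:E < lifetime y)%E ->
    x s @[s --> t^'+] --> x t /\ \forall s \near t^'+, y s = y t;
  kc_left : forall t : R, 0 < t -> (t%:E <= lifetime y)%E ->
    (exists l : R, x s @[s --> t^'-] --> l%:E) /\
    (exists i : E, \forall s \near t^'-, y s = Some i)
}.

(* A path observed on a (possibly random) set of times D is encoded as a function
   on R with value None outside D; this None means "not observed", and differs
   from the absorbing state Some (+oo, None). *)
Definition obs_path (R : realType) (E : finType) : Type :=
  R -> option (\bar R * option E).

Definition observe (R : realType) (E : finType) (D : set R) (x : R -> \bar R)
    (y : R -> option E) : obs_path R E :=
  fun t => if t \in D then Some (x t, y t) else None.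

Definition observe_from (R : realType) (E : finType) (T : R) (a : \bar R)
    (x : R -> \bar R) (y : R -> option E) : obs_path R E :=
  observe `[0, +oo[ (fun t => (x (T + t)%R - a)%E) (fun t => y (T + t)).

(* The sigma-algebra generated by the coordinates. As E is finite, it contains
   the events [p t = None], hence the information about D. *)
Definition path_event (R : realType) (E : finType) : set (set (obs_path R E)) :=
  <<s [set C | exists (t : R) (A : set (\bar R)) (j : option E), measurable A /\
         C = [set p | exists2 a, A a & p t = Some (a, j)]] >>.

Definition cprob (R : realType) (d : measure_display) (Omega : measurableType d)
    (P : probability Omega R) (H A : set Omega) : R :=
  fine (P (A `&` H)) / fine (P H).

Definition cindep (R : realType) (E : finType) (d : measure_display)
    (Omega : measurableType d) (P : probability Omega R) (H : set Omega)
    (Y Z : Omega -> obs_path R E) : Prop :=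
  forall A B, path_event A -> path_event B ->
    cprob P H (Y @^-1` A `&` Z @^-1` B) =
    cprob P H (Y @^-1` A) * cprob P H (Z @^-1` B).

Record killed_MAP (R : realType) (E : finType) (d : measure_display)
    (Omega : measurableType d) (P : E -> probability Omega R)
    (X : Omega -> R -> \bar R) (J : Omega -> R -> option E) : Prop := KilledMAP {
  map_X_meas : forall t : R, 0 <= t -> measurable_fun setT (X ^~ t);
  map_J_meas : forall (t : R) (j : option E), 0 <= t ->
    measurable [set w | J w t = j];
  map_cadlag : forall w, killed_cadlag (X w) (J w);
  map_start : forall k, P k [set w | X w 0 = 0%E /\ J w 0 = Some k] = 1%E;
  map_indep : forall (k i : E) (T : R), 0 <= T ->
    (0 < P k [set w | J w T = Some i])%E ->
    cindep (P k) [set w | J w T = Some i]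
      (fun w => observe `[0, T] (X w) (J w))
      (fun w => observe_from T (X w T) (X w) (J w));
  map_law : forall (k i : E) (T : R), 0 <= T ->
    (0 < P k [set w | J w T = Some i])%E ->
    forall B, path_event B ->
    cprob (P k) [set w | J w T = Some i]
      [set w | B (observe_from T (X w T) (X w) (J w))] =
    fine (P i [set w | B (observe `[0, +oo[ (X w) (J w))])
}.

Definition irreducible_phase (R : realType) (E : finType) (d : measure_display)
    (Omega : measurableType d) (P : E -> probability Omega R)
    (J : Omega -> R -> option E) : Prop :=
  forall i j : E, exists2 t : R, 0 <= t & (0 < P i [set w | J w t = Some j])%E.

Definition killing_rates (R : realType) (E : finType) (d : measure_display)
    (Omega : measurableType d) (P : E -> probability Omega R)
    (J : Omega -> R -> option E) (q : E -> R) : Prop :=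
  forall i : E,
    fine (P i [set w | J w t = None]) / t @[t --> (0 : R)^'+] --> q i.

(* Main.v *)
(** The last time T = qh at which a path sampled on a grid of mesh h attains its
    minimum splits exactly: {T = qh, J_T = j} is the intersection of an event of
    the past of qh, of {J_qh = j} and of an event of the future of qh, so the
    Markov property at qh makes the past and the future of T independent given
    {J_T = j}. The minimum over the grid is taken not for X but for
    X_t - delta (t + kappa 1_{J_t = j}). This breaks the ties: for delta small
    the argmin is close to the last time G of the infimum, and it lies on the side
    of G where the phase is j. Letting h, delta and kappa go to 0, in this order,
    transfers the splitting to G. In the limit the cases X_G = inf X and
    X_G > inf X are told apart by the initial value of the post-infimum process,
    so that they can be added to the conditioning. The argument needs a finite
    life time, which follows from irreducibility and q <> 0. *)
Require Import Defs.
From mathcomp Require Import all_boot all_order all_algebra.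
From mathcomp Require Import all_classical all_reals all_analysis measurable_realfun.
From mathcomp Require Import lra.

Set Implicit Arguments.
Unset Strict Implicit.
Unset Printing Implicit Defensive.

Import Order.TTheory GRing.Theory Num.Theory.
Import numFieldNormedType.Exports.

Local Open Scope classical_set_scope.
Local Open Scope ring_scope.

(** * Iterated limits of probabilities *)

(** The time G is not a stopping time and the Markov property is given at deterministic times only;
    hence the grid. On a grid, the probability that the past of T lies in F, its future in B and J_T
    = j is a product a(F) b(B). Neither factor needs to converge, so what passes to the limit is the
    exchange identity between the four products built from F, F', B, B', and nothing is divided
    before the limit. The argmin T may approach G from either side, so the path read exactly at T
    has no reason to converge. With e the lag, |T - G| < e eventually; the past is therefore cut at
    T - e, which lies before G, and the future is read from T + e, which lies after G. The bonus is
    worth a time kappa = e/2, too little to move T by e. How small the drift and then the mesh must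
    be depends on the path: the drift on the gap between path and infimum after G, the mesh on the
    set where the path is close to its infimum. This forces iterated limits, taken path by path
    outside a null set. They are established for simple events only, and Dynkin's lemma extends the
    outcome to the generated sigma-algebras. *)

Definition iter_filter (T : Type) (F : set_system T) : set_system (nat * T) :=
  [set Q | \forall l \near \oo, F [set y | Q (l, y)]].

Instance iter_filter_filter (T : Type) (F : set_system T) {FF : Filter F} :
  Filter (iter_filter F).
Proof.
split.
- by apply: nearW => l; exact: filterT.
- by move=> A B; apply: (@filterS2 _ (nbhs \oo)) => l; exact: filterI.
- move=> A B AB; apply: (@filterS _ (nbhs \oo)) => l.
  by apply: filterS => y; exact: AB.
Qed.

Instance iter_filter_proper (T : Type) (F : set_system T)
  {FF : ProperFilter F} : ProperFilter (iter_filter F).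
Proof.
apply: Build_ProperFilter_ex => Q FQ.
have [l FQl] := @filter_ex _ (nbhs (\oo : set_system nat)) _ _ FQ.
by have [y Qy] := filter_ex FQl; exists (l, y).
Qed.

(* Reverse Fatou along F: the set of points lying in B_x for F-frequently many x
   is covered by a measurable set whose measure bounds that of B_x from above. *)
Definition reverse_fatou (R : realType) (d : measure_display)
    (T : measurableType d) (mu : probability T R) (I : Type)
    (F : set_system I) :=
  forall B : I -> set T, (forall x, measurable (B x)) ->
    exists2 L : set T, measurable L &
      (forall w, F [set x | ~ B x w] -> ~ L w) /\
      (forall e : R, 0 < e -> F [set x | (mu (B x) < mu L + e%:E)%E]).

Lemma reverse_fatou_nat (R : realType) (d : measure_display)
    (T : measurableType d) (mu : probability T R) :
  reverse_fatou mu (nbhs (\oo : set_system nat)).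
Proof.
move=> B mB; exists (lim_sup_set B).
  by apply: bigcap_measurable => // n _; exact: bigcup_measurable.
split=> [w [N _ NB] Lw|e e0].
  by have [k /= Nk Bk] := Lw N I; exact: (NB k).
have mU n : measurable (\bigcup_(k >= n) B k) by exact: bigcup_measurable.
have mL : measurable (lim_sup_set B) by apply: bigcap_measurable.
have Loo : mu (lim_sup_set B) \is a fin_num by exact: fin_num_measure.
have Bcvg := lim_sup_set_cvg mu B mB.
have {}Bcvg : mu (\bigcup_(k >= n) B k) @[n --> \oo] --> mu (lim_sup_set B).
  by apply: Bcvg; rewrite (le_lt_trans (probability_le1 mu (mU 0%N)))// ltry.
have : \forall n \near \oo, (mu (\bigcup_(k >= n) B k) < mu (lim_sup_set B) + e%:E)%E.
  apply: (Bcvg [set y | (y < mu (lim_sup_set B) + e%:E)%E]).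
  apply: open_nbhs_nbhs; split; first exact: open_ereal_lt_ereal.
  by rewrite /= lteDl// lte_fin.
apply: filterS => n; apply: le_lt_trans.
by apply: le_measure; rewrite ?inE// => w Bw; exists n => /=.
Qed.

(** Applied for each l, the inner property yields a set [L l]; the sequence case applied to these
    sets yields the bound, with e/2 spent on each level. *)
Lemma reverse_fatou_iter (R : realType) (d : measure_display)
    (T : measurableType d) (mu : probability T R) (I : Type)
    (F : set_system I) {FF : Filter F} :
  reverse_fatou mu F -> reverse_fatou mu (iter_filter F).
Proof.
move=> FmF B mB.
have FmFl l : exists L, [/\ measurable L,
    (forall w, F [set y | ~ B (l, y) w] -> ~ L w) &
    (forall e : R, 0 < e -> F [set y | (mu (B (l, y)) < mu L + e%:E)%E])].
  have [L mL [L1 L2]] := FmF (fun y => B (l, y)) (fun y => mB (l, y)).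
  by exists L.
have [L PL] := choice FmFl.
have mL l : measurable (L l) by have [] := PL l.
have [K mK [K1 K2]] := reverse_fatou_nat mu mL.
exists K => //; split=> [w wB|e e0].
  apply: K1; apply: (@filterS _ (nbhs (\oo : set_system nat)) _ _ _ _ wB) => l.
  by have [_ + _] := PL l; exact.
have e20 : 0 < e / 2 by rewrite divr_gt0.
apply: (@filterS _ (nbhs (\oo : set_system nat)) _ _ _ _ (K2 _ e20)) => l /= Ll.
have [_ _ /(_ _ e20)] := PL l.
apply: filterS => y /= /lt_trans; apply.
by rewrite [in ltRHS](splitr e) EFinD addeA lteD2rE.
Qed.

(** Stands in for dominated convergence of indicators, which is a statement about sequences. Almost
    every point eventually leaves the symmetric difference of [V x] and L, so its covering set is
    null and its measure tends to 0. *)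
Lemma reverse_fatou_cvg (R : realType) (d : measure_display)
    (T : measurableType d) (mu : probability T R) (I : Type)
    (F : set_system I) {FF : Filter F} (V : I -> set T) (L N : set T) :
  reverse_fatou mu F ->
  (forall x, measurable (V x)) -> measurable L -> measurable N -> mu N = 0%E ->
  (forall w, ~ N w -> F [set x | V x w <-> L w]) ->
  fine (mu (V x)) @[x --> F] --> fine (mu L).
Proof.
move=> FmF mV mL mN N0 VL.
pose B x := (V x `\` L) `|` (L `\` V x).
have mB x : measurable (B x).
  by apply: measurableU; exact: measurableD.
have [K mK [K1 K2]] := FmF B mB.
have K0 : mu K = 0%E.
  apply: (subset_measure0 mK mN) => // w Kw; apply: contrapT => Nw.
  apply: (K1 w) => //; apply: filterS (VL w Nw) => x /= [VLw LVw].
  by case=> [[/VLw]|[/LVw]].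
apply/cvgrPdist_lt => e e0; apply: filterS (K2 e e0) => x /=.
rewrite K0 add0e; set V' := V x.
have mV' : measurable V' by exact: mV.
have fmu A : measurable A -> mu A \is a fin_num by exact: fin_num_measure.
have VI : measurable (V' `&` L) by exact: measurableI.
have mVL : measurable (V' `\` L) by exact: measurableD.
have mLV : measurable (L `\` V') by exact: measurableD.
rewrite measureU//; last first.
  by rewrite -subset0 => w [[? ?] [? ?]].
have -> : fine (mu V') = fine (mu (V' `\` L)) + fine (mu (V' `&` L)).
  by rewrite -fineD ?fmu// -measureDI.
have -> : fine (mu L) = fine (mu (L `\` V')) + fine (mu (V' `&` L)).
  by rewrite setIC -fineD ?fmu -?measureDI//; rewrite setIC.
rewrite [X in (X < _)%E](_ : _ = (fine (mu (V' `\` L)) + fine (mu (L `\` V')))%:E);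
  last by rewrite EFinD !fineK ?fmu.
rewrite lte_fin opprD addrACA subrr addr0.
apply: le_lt_trans; rewrite (le_trans (ler_normB _ _))//.
by rewrite addrC !ger0_norm ?fine_ge0.
Qed.

(** * One-sided neighbourhoods and compactness of segments *)

Lemma near_at_rightP (R : realType) (t : R) (Q : R -> Prop) :
  (\forall s \near t^'+, Q s) <->
  exists2 e : R, 0 < e & forall s, t < s < t + e -> Q s.
Proof.
split=> [[e /= e0 eQ]|[e e0 eQ]].
  exists e => // s /andP[ts st]; apply: eQ => //=.
  by rewrite distrC gtr0_norm ?subr_gt0// ltrBlDl.
near=> s; apply: eQ; apply/andP; split; near: s.
- exact: nbhs_right_gt.
- by apply: nbhs_right_lt; rewrite ltrDl.
Unshelve. all: by end_near. Qed.

Lemma near_at_leftP (R : realType) (t : R) (Q : R -> Prop) :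
  (\forall s \near t^'-, Q s) <->
  exists2 e : R, 0 < e & forall s, t - e < s < t -> Q s.
Proof.
split=> [[e /= e0 eQ]|[e e0 eQ]].
  exists e => // s /andP[ts st]; apply: eQ => //=.
  by rewrite gtr0_norm ?subr_gt0// ltrBlDl -ltrBlDr.
near=> s; apply: eQ; apply/andP; split; near: s.
- by apply: nbhs_left_gt; rewrite ltrBlDr ltrDl.
- exact: nbhs_left_lt.
Unshelve. all: by end_near. Qed.

Lemma cvg_ereal_gt (R : realType) (T : Type) (F : set_system T) {FF : Filter F}
    (f : T -> \bar R) (l c : \bar R) :
  f @ F --> l -> (c < l)%E -> \forall s \near F, (c < f s)%E.
Proof.
move=> fl cl; apply: (fl [set y | (c < y)%E]).
by apply: open_nbhs_nbhs; split => //; exact: open_ereal_gt_ereal.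
Qed.

Lemma cvg_ereal_lt (R : realType) (T : Type) (F : set_system T) {FF : Filter F}
    (f : T -> \bar R) (l c : \bar R) :
  f @ F --> l -> (l < c)%E -> \forall s \near F, (f s < c)%E.
Proof.
move=> fl lc; apply: (fl [set y | (y < c)%E]).
by apply: open_nbhs_nbhs; split => //; exact: open_ereal_lt_ereal.
Qed.

(** Compactness with one parameter e playing two roles: radius of the neighbourhood and strength of
    the property Q. Monotonicity in e allows both to be shrunk together. *)
Lemma segment_uniform_radius (R : realType) (a b : R) (Q : R -> R -> Prop) :
  a <= b ->
  (forall e e' s : R, 0 < e' -> e' <= e -> Q e s -> Q e' s) ->
  (forall t : R, a <= t <= b -> exists2 e : R, 0 < e & forall s : R, `|s - t| < e -> Q e s) ->
  exists2 e : R, 0 < e & forall s : R, a - e < s < b + e -> Q e s.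
Proof.
move=> ab Qmono Qloc.
have /compact_near_coveringP/(_ R (0 : R)^'+
  (fun e t => forall s, `|s - t| < e -> Q e s)) cov := @segment_compact R a b.
have {}cov : \forall e \near (0 : R)^'+,
    `[a, b]%classic `<=` (fun t => forall s, `|s - t| < e -> Q e s).
  apply: cov => t /=; rewrite in_itv/= => tab.
  have [e0 e00 eQ] := Qloc t tab.
  near=> t' e => s /= st'.
  have e_gt0 : 0 < e by near: e; exact: nbhs_right_gt.
  have e_lt : e < e0 / 2.
    by near: e; apply: nbhs_right_lt; rewrite divr_gt0.
  have t't : `|t' - t| < e0 / 2.
    by near: t'; apply: (@cvgr_distC_lt _ _ _ (nbhs t) _ id) => //; rewrite divr_gt0.
  apply: (Qmono e0) => //; first by apply/ltW/(lt_trans e_lt); lra.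
  by apply: eQ; rewrite (le_lt_trans (ler_distD (t' : R) _ _))//; lra.
have [e [e0 eQ]] : exists e, 0 < e /\
    `[a, b]%classic `<=` (fun t => forall s, `|s - t| < e -> Q e s).
  apply: (@filter_ex _ (0 : R)^'+); near=> e; split; last by near: e.
  by near: e; exact: nbhs_right_gt.
exists e => // s /andP[as_ sb].
have [sa|as'] := ltP s a.
  apply: (eQ a); first by rewrite /= in_itv/= lexx.
  by rewrite ltr0_norm ?subr_lt0//; lra.
have [bs|sb'] := ltP b s.
  apply: (eQ b); first by rewrite /= in_itv/= lexx andbT.
  by rewrite gtr0_norm ?subr_gt0//; lra.
by apply: (eQ s); rewrite /= ?in_itv/= ?as'// subrr normr0.
Unshelve. all: by end_near. Qed.

(** * Killed cadlag paths *)

(** The lower semicontinuous version of a cadlag path: its minimum over a compact interval is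
    attained, while that of [x] may only be approached from the left. *)
Definition lower_value (R : realType) (x : R -> \bar R) (t : R) : \bar R :=
  mine (x t) (left_value x t).

Section killed_path.
Context {R : realType} {E : finType} (x : R -> \bar R) (y : R -> option E).
Hypothesis hxy : killed_cadlag x y.
Implicit Types e s t : R.
Local Notation M := (lower_value x).

Lemma alive_phase t : 0 <= t -> (t%:E < lifetime y)%E -> y t <> None.
Proof.
move=> t0 tz yt; move: tz; apply/negP; rewrite -leNgt.
by apply: ereal_inf_lbound; exists t.
Qed.

Lemma phase_alive t : 0 <= t -> y t <> None -> (t%:E < lifetime y)%E.
Proof.
by move=> t0 yt; rewrite ltNge; apply/negP => /(kc_dead hxy t0)[].
Qed.

Lemma path_gtNy t : 0 <= t -> (-oo < x t)%E.
Proof.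
move=> t0; have [tz|tz] := ltP t%:E (lifetime y).
  by have := kc_fin hxy t0 tz; rewrite fin_numE => /andP[? _]; rewrite ltNye.
by have [-> _] := kc_dead hxy t0 tz.
Qed.

Lemma path_cvg_right t : 0 <= t -> x s @[s --> t^'+] --> x t.
Proof.
move=> t0; have [tz|tz] := ltP t%:E (lifetime y).
  by have [] := kc_right hxy t0 tz.
apply: cvg_near_cst; apply/near_at_rightP; exists 1 => // s /andP[ts _].
have s0 : 0 <= s by rewrite (le_trans t0)// ltW.
have [-> _] := kc_dead hxy t0 tz; have [|-> //] := kc_dead hxy s0.
by rewrite (le_trans tz)// lee_fin ltW.
Qed.

Lemma path_right_gt t c : 0 <= t -> (c < x t)%E ->
  exists2 e : R, 0 < e & forall s, t <= s < t + e -> (c < x s)%E.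
Proof.
move=> t0 cx; have [e e0 eP] := (near_at_rightP _ _).1 (cvg_ereal_gt (path_cvg_right t0) cx).
exists e => // s; rewrite le_eqVlt => /andP[/predU1P[<- //|ts] se].
by apply: eP; rewrite ts.
Qed.

Lemma path_right_lt t c : 0 <= t -> (x t < c)%E ->
  exists2 e : R, 0 < e & forall s, t <= s < t + e -> (x s < c)%E.
Proof.
move=> t0 cx; have [e e0 eP] := (near_at_rightP _ _).1 (cvg_ereal_lt (path_cvg_right t0) cx).
exists e => // s; rewrite le_eqVlt => /andP[/predU1P[<- //|ts] se].
by apply: eP; rewrite ts.
Qed.

Lemma phase_right t : 0 <= t ->
  exists2 e : R, 0 < e & forall s, t <= s < t + e -> y s = y t.
Proof.
move=> t0; have [tz|tz] := ltP t%:E (lifetime y).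
  have [_ /near_at_rightP[e e0 eP]] := kc_right hxy t0 tz.
  exists e => // s; rewrite le_eqVlt => /andP[/predU1P[<- //|ts] se].
  by apply: eP; rewrite ts.
exists 1 => // s /andP[ts _].
have s0 : 0 <= s by rewrite (le_trans t0).
have [_ ->] := kc_dead hxy t0 tz; have [|_ -> //] := kc_dead hxy s0.
by rewrite (le_trans tz).
Qed.

Lemma path_cvg_left t : 0 < t ->
  x s @[s --> t^'-] --> left_value x t /\
  ((t%:E <= lifetime y)%E -> left_value x t \is a fin_num) /\
  ((lifetime y < t%:E)%E -> left_value x t = +oo%E).
Proof.
move=> t0; rewrite /left_value gt_eqF//.
have [tz|tz] := leP t%:E (lifetime y).
  have [[l xl] _] := kc_left hxy t0 tz.
  by rewrite (cvg_lim _ xl).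
suff xl : x s @[s --> t^'-] --> +oo%E by rewrite (cvg_lim _ xl).
apply: cvg_near_cst; apply/near_at_leftP.
have zfin : lifetime y \is a fin_num.
  rewrite ge0_fin_numE; first by rewrite (lt_trans tz)// ltry.
  by apply: le_ereal_inf_tmp => _ [s [s0 _] <-]; rewrite lee_fin.
exists (t - fine (lifetime y)).
  by rewrite subr_gt0 -lte_fin fineK.
move=> s; rewrite opprB addrCA subrr addr0 => /andP[zs st].
have s0 : 0 <= s.
  apply/ltW/(le_lt_trans _ zs)/fine_ge0.
  by apply: le_ereal_inf_tmp => _ [r [r0 _] <-]; rewrite lee_fin.
have [|-> //] := kc_dead hxy s0.
by rewrite -(fineK zfin) lee_fin ltW.
Qed.

Lemma left_value_gt t c : 0 < t -> (c < left_value x t)%E ->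
  exists2 e : R, 0 < e & forall s, t - e < s < t -> (c < x s)%E.
Proof.
move=> t0 cx; have [xl _] := path_cvg_left t0.
exact: (near_at_leftP _ _).1 (cvg_ereal_gt xl cx).
Qed.

Lemma left_value_lt t c : 0 < t -> (left_value x t < c)%E ->
  exists2 e : R, 0 < e & forall s, t - e < s < t -> (x s < c)%E.
Proof.
move=> t0 cx; have [xl _] := path_cvg_left t0.
exact: (near_at_leftP _ _).1 (cvg_ereal_lt xl cx).
Qed.

Lemma phase_left t : 0 < t -> (t%:E <= lifetime y)%E ->
  exists2 e : R, 0 < e & forall s, t - e < s < t -> y s = left_phase y t.
Proof.
move=> t0 tz; have [_ [i yi]] := kc_left hxy t0 tz.
have /near_at_leftP[e e0 eP] : \forall s \near t^'-, y s = left_phase y t.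
  rewrite /left_phase gt_eqF//.
  by case: xgetP => [j _ //|/(_ (Some i))/(_ yi)].
by exists e.
Qed.

Lemma lower_value_gt t c : 0 <= t -> (c < M t)%E ->
  exists2 e : R, 0 < e & forall s, `|s - t| < e -> 0 <= s -> (c < x s)%E.
Proof.
rewrite /lower_value lt_min => t0 /andP[cx cl].
have [e1 e10 e1P] := path_right_gt t0 cx.
have [e2 e20 e2P] : exists2 e : R, 0 < e &
    forall s, t - e < s < t -> 0 <= s -> (c < x s)%E.
  move: t0 cl; rewrite le_eqVlt => /predU1P[<- _|t0 cl].
    by exists 1 => // s /andP[_ s0]; rewrite leNgt s0.
  by have [e e0 eP] := left_value_gt t0 cl; exists e => // s ? _; exact: eP.
exists (Num.min e1 e2) => [|s]; first by rewrite lt_min e10.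
rewrite lt_min !ltr_norml => /andP[/andP[_ se1] /andP[se2 _]] s0.
have [ts|st] := leP t s; first by apply: e1P; rewrite ts; lra.
by apply: e2P => //; rewrite st andbT; lra.
Qed.

Lemma lower_value_ge t (c : \bar R) e : 0 <= t -> 0 < e ->
  (forall s, t - e < s < t + e -> 0 <= s -> (c <= x s)%E) -> (c <= M t)%E.
Proof.
move=> t0 e0 eP; rewrite /lower_value le_min; apply/andP; split; first by apply: eP => //; lra.
move: t0; rewrite le_eqVlt => /predU1P[t0|t0].
  by rewrite /left_value -t0 eqxx; apply: eP => //; lra.
rewrite leNgt; apply/negP => /(left_value_lt t0)[e' e'0 e'P].
pose s := t - Num.min t (Num.min e e') / 2.
have m0 : 0 < Num.min t (Num.min e e') by rewrite !lt_min t0 e0.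
have [m1 m2 m3] : [/\ Num.min t (Num.min e e') <= t,
    Num.min t (Num.min e e') <= e & Num.min t (Num.min e e') <= e'].
  by rewrite !ge_min !lexx !orbT.
have : (x s < c)%E by apply: e'P; rewrite /s; lra.
by apply/negP; rewrite -leNgt; apply: eP; rewrite /s; lra.
Qed.

(** Compactness turns the pointwise strict inequality into a uniform gap e, valid also on a margin e
    around the segment. The margin matters even for a segment reduced to a point. *)
Lemma lower_value_gt_segment (a b c : R) : 0 <= a -> a <= b ->
  (forall t, a <= t <= b -> (c%:E < M t)%E) ->
  exists2 e : R, 0 < e &
    forall s, a - e < s < b + e -> 0 <= s -> ((c + e)%:E <= x s)%E.
Proof.
move=> a0 ab cM.
apply: (@segment_uniform_radius _ a b
  (fun e s => 0 <= s -> ((c + e)%:E <= x s)%E)) => //.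
  move=> e e' s _ e'e cx s0; apply: le_trans (cx s0).
  by rewrite lee_fin lerD2l.
move=> t tab; have t0 : 0 <= t by case/andP: tab => ? _; exact: le_trans a0 _.
have [c' c'0 c'M] : exists2 c' : R, 0 < c' & ((c + c')%:E < M t)%E.
  move: (cM t tab); case: (M t) => [m||//].
    by rewrite lte_fin => cm; exists ((m - c) / 2); rewrite ?lte_fin; lra.
  by exists 1 => //; rewrite ltry.
have [e e0 eP] := lower_value_gt t0 c'M.
exists (Num.min e c') => [|s]; first by rewrite lt_min e0.
rewrite lt_min => /andP[ste _] s0.
apply: le_trans (ltW (eP _ ste s0)).
by rewrite lee_fin lerD2l ge_min lexx orbT.
Qed.

(** The path is +oo from the life time on, so these times do not affect the infimum. *)
Lemma overall_inf_ge c :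
  (c <= overall_inf x y)%E <-> (forall t, 0 <= t -> (c <= x t)%E).
Proof.
split=> [cI t t0|cx]; last first.
  by apply: le_ereal_inf_tmp => _ [t [t0 _] <-]; exact: cx.
have [tz|tz] := ltP t%:E (lifetime y); last first.
  by have [-> _] := kc_dead hxy t0 tz; rewrite leey.
by rewrite (le_trans cI)//; apply: ereal_inf_lbound; exists t.
Qed.

Lemma overall_inf_le t : 0 <= t -> (overall_inf x y <= x t)%E.
Proof. exact: ((overall_inf_ge _).1 (lexx _) t). Qed.

Lemma overall_inf_le_lower_value t : 0 <= t -> (overall_inf x y <= M t)%E.
Proof.
by move=> t0; apply: (@lower_value_ge _ _ 1) => // s _; exact: overall_inf_le.
Qed.

Lemma lower_value_dead t : 0 <= t -> (lifetime y < t%:E)%E -> M t = +oo%E.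
Proof.
rewrite /lower_value le_eqVlt => /predU1P[<-|t0] zt.
  rewrite /left_value eqxx minxx.
  by have [->] := kc_dead hxy (lexx 0) (ltW zt).
have [_ [_ ->//]] := path_cvg_left t0.
by have [-> _] := kc_dead hxy (ltW t0) (ltW zt); rewrite minxx.
Qed.

Lemma lower_value_gtNy t : 0 <= t -> (-oo < M t)%E.
Proof.
move=> t0; have [zt|tz] := ltP (lifetime y) t%:E; first by rewrite lower_value_dead.
rewrite /lower_value lt_min path_gtNy//=.
move: t0; rewrite le_eqVlt => /predU1P[<-|t0].
  by rewrite /left_value eqxx path_gtNy.
have [_ [/(_ tz) + _]] := path_cvg_left t0.
by rewrite fin_numE => /andP[? _]; rewrite ltNye.
Qed.

End killed_path.

(** * Argmin of the perturbed path over a grid *)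

(* The drift selects the last among the times at which the infimum is reached,
   and the bonus for phase j selects the side of that time on which J = j. *)
Definition perturbed (R : realType) (E : finType) (j : E) (delta kappa : R)
    (x : R -> \bar R) (y : R -> option E) (t : R) : \bar R :=
  (x t - (delta * (t + kappa * (y t == Some j)%:R))%:E)%E.

(** Weak inequalities on the left and strict ones on the right select the last minimiser. It is
    therefore unique, which makes the events indexed by q disjoint, and the strict inequality at q +
    1 forces the value at q to be finite, hence the path to be alive there. *)
Definition grid_argmin (R : realType) (E : finType) (j : E)
    (delta kappa h : R) (x : R -> \bar R) (y : R -> option E) (q : nat) : Prop :=
  let W l := perturbed j delta kappa x y (l%:R * h) in
  (forall l, (l < q)%N -> (W q <= W l)%E) /\
  (forall l, (q < l)%N -> (W q < W l)%E).

Lemma last_argmin (R : realType) (f : nat -> \bar R) (N : nat) :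
  exists2 q, (q <= N)%N &
    (forall l, (l < q)%N -> (f q <= f l)%E) /\
    (forall l, (q < l <= N)%N -> (f q < f l)%E).
Proof.
elim: N => [|N [q qN [q1 q2]]].
  exists 0%N => //; split=> // l /andP[l0 lN].
  by move: l0; rewrite ltnNge lN.
have qf l : (l <= N)%N -> (f q <= f l)%E.
  move=> lN; have [lq|ql|->//] := ltngtP l q; first exact: q1.
  by apply/ltW/q2; rewrite ql.
have [fN|fN] := leP (f N.+1) (f q).
  exists N.+1 => //; split=> [l|l /andP[Nl lN]].
    by rewrite ltnS => /qf; exact: le_trans.
  by move: Nl; rewrite ltnNge lN.
exists q; first exact: leqW.
split=> // l /andP[ql]; rewrite leq_eqVlt => /predU1P[->//|lN].
by apply: q2; rewrite ql.
Qed.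

Lemma grid_point (R : realType) (a b : R) : 0 <= a -> a < b ->
  \forall m \near \oo, exists q : nat, a < q%:R * m.+1%:R^-1 < b.
Proof.
move=> a0 ab; near=> m.
have hm : m.+1%:R^-1 < b - a :> R.
  by near: m; apply: near_infty_natSinv_lt (PosNum _); rewrite subr_gt0.
have m0 : 0 < m.+1%:R^-1 :> R by rewrite invr_gt0.
have am : 0 <= a * m.+1%:R by rewrite mulr_ge0.
have /andP[q1 q2] := Num.Theory.truncn_itv am.
exists (Num.truncn (a * m.+1%:R)).+1; apply/andP; split.
  by rewrite ltr_pdivlMr.
rewrite -natr1 mulrDl mul1r -ltrBrDr (le_lt_trans _ _ (y := a))//.
  by rewrite ler_pdivrMr.
by rewrite ltrBrDl -ltrBrDr.
Unshelve. all: by end_near. Qed.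

(** * The infimum time of a path with finite life time and the argmin near it *)

Section finite_lifetime.
Context {R : realType} {E : finType} (x : R -> \bar R) (y : R -> option E).
Hypothesis hxy : killed_cadlag x y.
Variable z : R.
Hypotheses (hz : lifetime y = z%:E) (z_gt0 : 0 < z).
Implicit Types (e s t : R) (j : E).
Local Notation M := (lower_value x).
Let G := inf_time x y.

Lemma overall_inf_fin_num : overall_inf x y \is a fin_num.
Proof.
have xfin0 : x 0 \is a fin_num by apply: (kc_fin hxy) => //; rewrite hz lte_fin.
rewrite fin_numE; apply/andP; split; last first.
  rewrite -ltey (le_lt_trans (overall_inf_le hxy (lexx 0)))//.
  by rewrite -(fineK xfin0) ltry.
(* The lower bound is coded as -1/e, so that a smaller radius goes with a weaker bound. *)
have [||t /andP[t0 _]|e e0 eP] := @segment_uniform_radius _ 0 z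
  (fun e s => 0 <= s -> ((- e^-1)%:E <= x s)%E).
- exact: ltW.
- move=> e e' s e'0 e'e xs s0; apply: le_trans (xs s0).
  by rewrite lee_fin lerN2 lef_pV2// posrE (lt_le_trans e'0).
- have [c cM] : exists c : R, (c%:E < M t)%E.
    have := lower_value_gtNy hxy t0; case: (M t) => [m _|_|//].
      by exists (m - 1); rewrite lte_fin; lra.
    by exists 0; rewrite ltry.
  have [e e0 eP] := lower_value_gt hxy t0 cM.
  exists (Num.min e (`|c| + 1)^-1) => [|s].
    by rewrite lt_min e0 invr_gt0 ltr_wpDl.
  rewrite lt_min => /andP[se _] s0; apply/ltW/(le_lt_trans _ (eP s se s0)).
  rewrite lee_fin lerNl (le_trans (ler_norm _))// normrN.
  rewrite (@le_trans _ _ (`|c| + 1))//; first by rewrite lerDl.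
  rewrite -[leLHS]invrK lef_pV2// ?posrE ?lt_min ?e0 ?invr_gt0 ?ltr_wpDl//.
  by rewrite ge_min lexx orbT.
- rewrite -ltNye (@lt_le_trans _ _ (- e^-1)%:E) ?ltNyr//.
  apply/(overall_inf_ge hxy) => t t0.
  have [tz|zt] := ltP t z; first by apply: eP => //; lra.
  by have [|->] := kc_dead hxy t0; rewrite ?leey// hz lee_fin.
Qed.

Let I := fine (overall_inf x y).

Lemma overall_infK : overall_inf x y = I%:E.
Proof. by rewrite /I fineK// overall_inf_fin_num. Qed.

(** Both the infimum and the supremum defining G are attained. If [M] exceeded the infimum on all of
    [0, z], it would do so by a uniform gap; if it did so at G, the same would hold near G, although
    infimum times accumulate at their supremum. *)
Lemma inf_timeP : [/\ 0 <= G, G <= z, M G = I%:E &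
  forall t, G < t -> (I%:E < M t)%E].
Proof.
pose S := [set t : R | [/\ 0 <= t, (t%:E <= lifetime y)%E & M t = overall_inf x y]].
have SE t : 0 <= t -> t <= z -> ~ S t -> (I%:E < M t)%E.
  move=> t0 tz nS; rewrite lt_neqAle -overall_infK (overall_inf_le_lower_value hxy t0) andbT.
  by apply/eqP => MI; apply: nS; split => //; rewrite hz lee_fin.
have S0 : S !=set0.
  apply/set0P/negP => /eqP S0.
  have [t /andP[t0 tz]|e e0 eP] := lower_value_gt_segment (c := I) hxy (lexx 0) (ltW z_gt0).
    by apply: SE => //; rewrite S0.
  have : ((I + e)%:E <= overall_inf x y)%E.
    apply/(overall_inf_ge hxy) => t t0.
    have [tz|zt] := ltP t z; first by apply: eP => //; lra.
    by have [|->] := kc_dead hxy t0; rewrite ?leey// hz lee_fin.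
  by rewrite overall_infK lee_fin; lra.
have Sz : ubound S z by move=> t [_ + _]; rewrite hz lee_fin.
have Ssup : has_sup S by split=> //; exists z.
have SG t : S t -> t <= G by move=> St; apply: ub_le_sup => //; exists z.
have G0 : 0 <= G.
  by case: S0 => t St; apply: (le_trans _ (SG t St)); case: St.
have Gz : G <= z by apply: ge_sup.
have IMt t : G < t -> (I%:E < M t)%E.
  move=> Gt; have t0 : 0 <= t by rewrite (le_trans G0)// ltW.
  have [tz|zt] := leP t z; last by rewrite (lower_value_dead hxy)// ?ltry// hz lte_fin.
  by apply: SE => // St; move: Gt; rewrite ltNge SG.
split => //; apply: contrapT => MG.
have {}MG : (I%:E < M G)%E.
  by apply: SE => // -[_ _]; rewrite overall_infK.
have [t /andP[Gt tG]|e e0 eP] := lower_value_gt_segment (c := I) hxy G0 (lexx G).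
  by have /eqP <- : G == t by rewrite eq_le Gt.
have [t St Gt] := @sup_adherent _ S _ e0 Ssup.
have tG := SG _ St; have t0 : 0 <= t by case: St.
pose e' := (t - (G - e)).
have e'0 : 0 < e' by rewrite /e' subr_gt0.
have : ((I + e)%:E <= M t)%E.
  apply: (lower_value_ge hxy t0 e'0) => s ste s0; apply: eP => //.
  by move: ste; rewrite /e'; lra.
by case: St => _ _ ->; rewrite overall_infK lee_fin; lra.
Qed.

Lemma overall_inf_leE t : 0 <= t -> (I%:E <= x t)%E.
Proof. by move=> t0; rewrite -overall_infK (overall_inf_le hxy). Qed.

Lemma inf_time_left : (overall_inf x y < x G)%E ->
  0 < G /\ left_value x G = overall_inf x y.
Proof.
move=> IG; have [G0 _ + _] := inf_timeP; rewrite /lower_value -overall_infK => MG.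
have lG : left_value x G = overall_inf x y.
  by move: MG; rewrite /mine; case: ifPn => // _ xG; rewrite xG ltxx in IG.
split=> //; move: G0; rewrite le_eqVlt => /predU1P[G0|//].
by move: lG IG; rewrite /left_value -G0 eqxx => ->; rewrite ltxx.
Qed.

Lemma near_inf_right (beta : R) : x G = overall_inf x y -> 0 < beta ->
  exists2 b : R, G < b < G + beta &
    forall s, G < s < b -> (x s < (I + beta)%:E)%E.
Proof.
move=> xG b0; have [G0 _ _ _] := inf_timeP.
have xG' : (x G < (I + beta)%:E)%E by rewrite xG overall_infK lte_fin ltrDl.
have [e e0 eP] := path_right_lt hxy G0 xG'.
exists (G + Num.min e beta / 2).
  have : 0 < Num.min e beta by rewrite lt_min e0.
  have : Num.min e beta <= beta by rewrite ge_min lexx orbT.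
  lra.
have : Num.min e beta <= e by rewrite ge_min lexx.
by move=> me s sG; apply: eP; lra.
Qed.

Lemma near_inf (beta : R) : 0 < beta -> exists a b : R, [/\ 0 <= a, a < b &
  forall s, a < s < b -> `|s - G| < beta /\ (x s < (I + beta)%:E)%E].
Proof.
move=> b0; have [G0 Gz MG _] := inf_timeP.
have [xG|xG] := eqVneq (x G) (overall_inf x y).
  have [b bG bP] := near_inf_right xG b0.
  exists G, b; split => //; first by lra.
  move=> s sGb; split; last exact: bP.
  by rewrite gtr0_norm; lra.
have [|G_gt0 lG] := inf_time_left.
  by rewrite lt_neqAle eq_sym xG overall_infK overall_inf_leE.
have lG' : (left_value x G < (I + beta)%:E)%E.
  by rewrite lG overall_infK lte_fin ltrDl.
have [e e0 eP] := left_value_lt hxy G_gt0 lG'.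
pose m := Num.min G (Num.min e beta) / 2.
have m0 : 0 < Num.min G (Num.min e beta) by rewrite !lt_min G_gt0 e0.
have [m1 m2 m3] : [/\ Num.min G (Num.min e beta) <= G,
    Num.min G (Num.min e beta) <= e & Num.min G (Num.min e beta) <= beta].
  by rewrite !ge_min !lexx !orbT.
exists (G - m), G; rewrite /m; split; [lra|lra|].
move=> s sG; split; last by apply: eP; lra.
by rewrite ltr0_norm; lra.
Qed.

Lemma grid_argmin_le j (delta kappa h : R) q l :
  grid_argmin j delta kappa h x y q ->
  (perturbed j delta kappa x y (q%:R * h) <=
   perturbed j delta kappa x y (l%:R * h))%E.
Proof.
by move=> [q1 q2]; have [/q1|/q2/ltW|->] := ltngtP l q.
Qed.

Lemma grid_argmin_alive j (delta kappa h : R) q : 0 <= h ->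
  grid_argmin j delta kappa h x y q -> q%:R * h < z.
Proof.
move=> h0 [_ /(_ _ (ltnSn q))]; rewrite ltNge => qh.
rewrite ltNge; apply: contra qh => zq.
have [|xq _] := kc_dead hxy (mulr_ge0 (ler0n R q) h0).
  by rewrite hz lee_fin.
by rewrite {2}/perturbed xq addye// leey.
Qed.

(** Here the finite life time is essential: the perturbed path is +oo on the grid from index N on
    and finite at 0, so the search is finite in spite of the negative drift. *)
Lemma grid_argmin_ex j (delta kappa h : R) : 0 < h ->
  exists q, grid_argmin j delta kappa h x y q.
Proof.
move=> h0; set W := fun l : nat => perturbed j delta kappa x y (l%:R * h).
pose N := (Num.truncn (z / h)).+1.
have zN : z < N%:R * h.
  have /andP[_] := Num.Theory.truncn_itv (divr_ge0 (ltW z_gt0) (ltW h0)).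
  by rewrite ltr_pdivrMr.
have Woo l : (N <= l)%N -> W l = +oo%E.
  move=> Nl; have l0 : 0 <= l%:R * h by rewrite mulr_ge0// ltW.
  have [|xl _] := kc_dead hxy l0; last by rewrite /W /perturbed xl addye.
  rewrite hz lee_fin (le_trans (ltW zN))//.
  by rewrite ler_pM2r// ler_nat.
have W0 : (W 0%N < +oo)%E.
  rewrite /W /perturbed mul0r -(fineK (kc_fin hxy _ _)) ?hz ?lte_fin//.
  by rewrite -EFinB ltry.
have [q qN [q1 q2]] := last_argmin W N.
exists q; split=> // l ql.
have [lN|Nl] := leqP l N; first by apply: q2; rewrite ql.
suff : (W q < W l)%E by [].
rewrite (Woo l) ?(ltnW Nl)//; apply: (le_lt_trans _ W0).
by case: q q1 {q2 ql qN} => // q /(_ 0%N); exact.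
Qed.

Lemma near_harmonic (a b : R) : 0 < b ->
  \forall n \near \oo, a * (n.+1%:R^-1 : R) < b.
Proof.
move=> b0; near=> n.
have a1 : 0 < `|a| + 1 by rewrite ltr_wpDl.
have hn : n.+1%:R^-1 < b / (`|a| + 1) :> R.
  by near: n; apply: near_infty_natSinv_lt (PosNum _); rewrite divr_gt0.
have n0 : 0 < n.+1%:R^-1 :> R by rewrite invr_gt0.
move: hn; rewrite ltr_pdivlMr// mulrC; apply: le_lt_trans.
by rewrite ler_pM2r// (le_trans (ler_norm a))// lerDl.
Unshelve. all: by end_near. Qed.

(* In both comparisons below the value at the argmin is at most the value at a
   grid point next to the infimum time: the first one forces X_T to be close to
   the infimum, hence T not to be far to the right of G, where X exceeds its
   infimum; in the second one the drift forbids T to be far to the left. *)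
Lemma grid_argmin_near j e : 0 < e ->
  \forall n \near \oo, \forall m \near \oo, forall q,
    grid_argmin j n.+1%:R^-1 (e / 2) m.+1%:R^-1 x y q ->
    let T := q%:R * m.+1%:R^-1 in
    [/\ G - e < T, T < G + e, T < z & (x T < (I + e)%:E)%E].
Proof.
move=> e0; have [G0 Gz MG MGt] := inf_timeP.
(* Since G >= 0, the right end [G + e / 2 + z] lies beyond the life time, so c is a gap valid at all
   times after G + e/2. *)
have [||t /andP[Gt _]|c c0 cP] := lower_value_gt_segment (a := G + e / 2)
  (b := G + e / 2 + z) (c := I) hxy; [lra|lra| |].
  by apply: MGt; lra.
have {}cP s : G + e / 2 <= s -> ((I + c)%:E <= x s)%E.
  move=> Gs; have [sz|zs] := leP s z; first by apply: cP; lra.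
  have [||-> _] := kc_dead hxy (t := s); rewrite ?leey//; first by lra.
  by rewrite hz lee_fin ltW.
have ec0 : 0 < Num.min e c / 2 by rewrite divr_gt0// lt_min e0.
have [ece ecc] : Num.min e c <= e /\ Num.min e c <= c.
  by rewrite !ge_min !lexx orbT.
apply: filterS (near_harmonic (z + e / 2) ec0) => n.
set delta : R := n.+1%:R^-1 => dz.
have d0 : 0 < delta by rewrite invr_gt0.
(* If T <= G - e, passing from T to s gains at least delta e/4 by the drift, bonus included, as s is
   within e/8 of G; an excess of [x s] below delta e/8 cannot compensate this. The third bound
   leaves the other half of min(e, c) to the drift term, which [dz] controls. *)
pose beta := Num.min (delta * (e / 8)) (Num.min (e / 8) (Num.min e c / 2)).
have beta0 : 0 < beta.
  by rewrite /beta !lt_min ec0 mulr_gt0//= ?divr_gt0.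
have [b1 b2 b3] : [/\ beta <= delta * (e / 8), beta <= e / 8 &
    beta <= Num.min e c / 2].
  by rewrite /beta !ge_min !lexx !orbT.
have [a [b [a0 ab abP]]] := near_inf beta0.
apply: filterS (grid_point a0 ab) => m [l /abP]; set s := l%:R * _.
rewrite ltr_norml => -[/andP[Gs sG] xs] q qmin; set T := q%:R * _.
have m0 : 0 <= m.+1%:R^-1 :> R by rewrite invr_ge0.
have T0 : 0 <= T by rewrite mulr_ge0.
have s0 : 0 <= s by rewrite mulr_ge0.
have Tz : T < z := grid_argmin_alive m0 qmin.
have := grid_argmin_le l qmin; rewrite /perturbed -/T -/s.
have xTfin : x T \is a fin_num by apply: (kc_fin hxy) => //; rewrite hz lte_fin.
have xsfin : x s \is a fin_num.
  rewrite fin_numE; apply/andP; split; first by rewrite -ltNye (path_gtNy hxy).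
  by rewrite -ltey (lt_trans xs)// ltry.
have IT := overall_inf_leE T0; move: xs IT.
rewrite -(fineK xTfin) -(fineK xsfin) -!EFinB !lee_fin !lte_fin.
set XT := fine (x T); set Xs := fine (x s) => xs IT.
set vT : R := (_ == _)%:R; set vs : R := (_ == _)%:R => WTs.
have [vT0 vT1] : 0 <= vT /\ vT <= 1 by rewrite /vT; case: (_ == _) => /=.
have [vs0 vs1] : 0 <= vs /\ vs <= 1 by rewrite /vs; case: (_ == _) => /=.
have TG : G - e < T.
  rewrite ltNge; apply/negP => TG.
  have : delta * (T + e / 2 * vT) <= delta * (T + e / 2) by rewrite ler_pM2l//; nra.
  have : delta * s <= delta * (s + e / 2 * vs) by rewrite ler_pM2l//; nra.
  have : delta * (T + e / 2) <= delta * (s - e / 4) by rewrite ler_pM2l//; lra.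
  lra.
have xT : XT < I + Num.min e c.
  have : delta * (T + e / 2 * vT) <= (z + e / 2) * delta.
    by rewrite mulrC ler_pM2r//; nra.
  have : 0 <= delta * (s + e / 2 * vs) by rewrite mulr_ge0//; nra.
  lra.
split=> //; last by lra.
rewrite ltNge; apply/negP => GT.
have : ((I + c)%:E <= x T)%E by apply: cP; lra.
by rewrite -(fineK xTfin) lee_fin -/XT; lra.
Qed.

(** At or just after G the phase is j. If T is before G in another phase, it loses against a grid
    point s just after G: s has the bonus delta e/2 and a later time, and [x s] exceeds the infimum
    by less than delta e/2. *)
Lemma grid_argmin_phase_attained j : x G = overall_inf x y -> y G = Some j ->
  exists2 e0 : R, 0 < e0 & forall e, 0 < e < e0 ->
  \forall n \near \oo, \forall m \near \oo, forall q,
    grid_argmin j n.+1%:R^-1 (e / 2) m.+1%:R^-1 x y q ->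
    y (q%:R * m.+1%:R^-1) = Some j.
Proof.
move=> xG yG; have [G0 Gz MG MGt] := inf_timeP.
have [e1 e10 yr] := phase_right hxy G0.
have [e2 e20 yl] : exists2 e : R, 0 < e &
    forall s, G - e < s < G -> 0 <= s -> y s = left_phase y G.
  move: G0; rewrite le_eqVlt => /predU1P[<-|G0].
    by exists 1 => // s /andP[_ s0]; rewrite leNgt s0.
  have [|e e0 eP] := phase_left hxy G0; first by rewrite hz lee_fin.
  by exists e => // s /eP.
exists (Num.min e1 e2) => [|e]; first by rewrite lt_min e10.
rewrite lt_min => /and3P[e0 ee1 ee2].
apply: filterS (grid_argmin_near j e0) => n nloc.
set delta : R := n.+1%:R^-1 in nloc *.
have d0 : 0 < delta by rewrite invr_gt0.
have [|b /andP[Gb be] bP] := near_inf_right (beta := Num.min e1 (delta * (e / 2))) xG.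
  by rewrite lt_min e10/= mulr_gt0// divr_gt0.
have [b1 b2] : Num.min e1 (delta * (e / 2)) <= e1 /\
    Num.min e1 (delta * (e / 2)) <= delta * (e / 2).
  by rewrite !ge_min !lexx !orbT.
apply: filterS2 nloc (grid_point G0 Gb) => m mloc [l]; set s := l%:R * _ => sGb.
move=> q qmin; set T := q%:R * _.
have [TG GT Tz xTI] := mloc q qmin; rewrite -/T in TG GT Tz xTI.
have m0 : 0 <= m.+1%:R^-1 :> R by rewrite invr_ge0.
have T0 : 0 <= T by rewrite mulr_ge0.
have s0 : 0 <= s by rewrite mulr_ge0.
have [GleT|TltG] := leP G T; first by rewrite yr ?yG//; lra.
have [//|yT] := eqVneq (y T) (Some j).
have := grid_argmin_le l qmin; rewrite /perturbed -/T -/s (negPf yT).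
have -> : y s == Some j by rewrite yr ?yG ?eqxx//; lra.
have xTfin : x T \is a fin_num by apply: (kc_fin hxy) => //; rewrite hz lte_fin.
have xs := bP s sGb.
have xsfin : x s \is a fin_num.
  rewrite fin_numE; apply/andP; split; first by rewrite -ltNye (path_gtNy hxy).
  by rewrite -ltey (lt_trans xs)// ltry.
have IT := overall_inf_leE T0; move: xs IT.
rewrite -(fineK xTfin) -(fineK xsfin) -!EFinB !lee_fin !lte_fin mulr0 mulr1 addr0.
move=> xs IT WTs; exfalso.
have : delta * T <= delta * s by rewrite ler_pM2l//; lra.
lra.
Qed.

(** Just after G the path stays above its infimum by a fixed c, whereas the value at T is within e <
    c of it. Hence T < G, whichever phase gets the bonus. *)
Lemma grid_argmin_phase_left j : (overall_inf x y < x G)%E ->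
  exists2 e0 : R, 0 < e0 & forall e, 0 < e < e0 ->
  \forall n \near \oo, \forall m \near \oo, forall q,
    grid_argmin j n.+1%:R^-1 (e / 2) m.+1%:R^-1 x y q ->
    y (q%:R * m.+1%:R^-1) = left_phase y G.
Proof.
move=> IG; have [G_gt0 lG] := inf_time_left IG.
have [G0 Gz MG MGt] := inf_timeP.
have [|e2 e20 yl] := phase_left hxy G_gt0; first by rewrite hz lee_fin.
have [c c0 cG] : exists2 c : R, 0 < c & ((I + c)%:E < x G)%E.
  move: IG; rewrite overall_infK; case: (x G) => [v||//].
    by rewrite lte_fin => vI; exists ((v - I) / 2); rewrite ?lte_fin; lra.
  by exists 1; rewrite ?ltry.
have [e1 e10 xr] := path_right_gt hxy G0 cG.
exists (Num.min c (Num.min e1 e2)) => [|e]; first by rewrite !lt_min c0 e10.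
rewrite !lt_min => /and4P[e0 ec ee1 ee2].
apply: filterS (grid_argmin_near j e0) => n; apply: filterS => m mloc q qmin.
set T := q%:R * _; have [TG GT Tz xTI] := mloc q qmin; rewrite -/T in TG GT Tz xTI.
have m0 : 0 <= m.+1%:R^-1 :> R by rewrite invr_ge0.
have T0 : 0 <= T by rewrite mulr_ge0.
have [GleT|TltG] := leP G T; last by apply: yl; lra.
have : ((I + c)%:E < x T)%E by apply: xr; lra.
rewrite ltNge => /negP; case; rewrite ltW// (lt_trans xTI)//.
by rewrite lte_fin; lra.
Qed.

End finite_lifetime.

(** * Limits at the argmin *)

(* A tuple (l, (k, (n, m))) stands for the mesh 1/(m+1) of the grid, the drift
   1/(n+1) of the perturbation, the time lag 1/(k+1) by which the past is
   shortened and the future delayed, and the margin 1/(l+1) in the levels of the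
   increments, sent to 0 in this order. *)
Definition scales := (nat * (nat * (nat * nat)))%type.

Definition level (R : realType) (p : scales) : R := p.1.+1%:R^-1.
Definition lag (R : realType) (p : scales) : R := p.2.1.+1%:R^-1.
Definition mesh (R : realType) (p : scales) : R := p.2.2.2.+1%:R^-1.

Definition lim_scales : set_system scales :=
  iter_filter (iter_filter (iter_filter (nbhs (\oo : set_system nat)))).

Instance lim_scales_proper : ProperFilter lim_scales := _.

Lemma lim_scales_reverse_fatou (R : realType) (d : measure_display)
    (T : measurableType d) (mu : probability T R) : reverse_fatou mu lim_scales.
Proof.
by do 3 apply: reverse_fatou_iter; exact: reverse_fatou_nat.
Qed.

(** The bonus is tied to the lag: with e the lag, kappa = e/2 is the value for which the argmin is
    localised within e of G. *)
Definition scale_argmin (R : realType) (E : finType) (j : E) (p : scales)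
    (x : R -> \bar R) (y : R -> option E) (q : nat) : Prop :=
  grid_argmin j p.2.2.1.+1%:R^-1 (lag R p / 2) (mesh R p) x y q.

Section limits_at_argmin.
Context {R : realType} {E : finType} (x : R -> \bar R) (y : R -> option E).
Hypothesis hxy : killed_cadlag x y.
Variable z : R.
Hypotheses (hz : lifetime y = z%:E) (z_gt0 : 0 < z).
Variable j : E.
Implicit Types (e s t c r : R).
Let G := inf_time x y.
Let I := fine (overall_inf x y).
Let argmin_near_inf (e : R) (T : R) :=
  [/\ G - e < T, T < G + e, 0 <= T, T < z & (x T < (I + e)%:E)%E].

(** Removes grid and perturbation from the limits: only the distance of T to G and the excess of the
    value at T, both controlled by the lag e, are retained. The level r is fixed before e. *)
Lemma lim_scales_argmin (Q : R -> R -> R -> Prop) :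
  (exists2 r0 : R, 0 < r0 & forall r, 0 < r < r0 ->
     exists2 e0 : R, 0 < e0 & forall e T, 0 < e < e0 ->
     argmin_near_inf e T -> Q r e T) ->
  lim_scales [set p | forall q, scale_argmin j p x y q ->
    Q (level R p) (lag R p) (q%:R * mesh R p)].
Proof.
move=> [r0 r00 Qnear].
apply: (@filterS _ (nbhs \oo) _ _ _ _ (near_infty_natSinv_lt (PosNum r00))) => l lr0.
have [|e0 e00 eQ] := Qnear (level R (l, (0, (0, 0)))%N).
  by rewrite invr_gt0 ltr0n.
apply: (@filterS _ (nbhs \oo) _ _ _ _ (near_infty_natSinv_lt (PosNum e00))) => k ke0.
set e : R := k.+1%:R^-1 in ke0.
have e_gt0 : 0 < e by rewrite invr_gt0.
have := grid_argmin_near hxy hz z_gt0 j e_gt0.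
apply: filterS => n; apply: filterS => m loc q qmin.
apply: eQ; first by rewrite e_gt0.
have [T1 T2 T3 T4] := loc q qmin.
by split=> //; rewrite mulr_ge0// invr_ge0.
Qed.

(** Since G - e < T < G + e, the time T - e lies in (G - 2e, G). It tends to G strictly from below,
    which also settles t = G. *)
Lemma lim_scales_before t : lim_scales [set p | forall q, scale_argmin j p x y q ->
  (t < q%:R * mesh R p - lag R p <-> t < G)].
Proof.
apply: (@lim_scales_argmin (fun r e T => t < T - e <-> t < G)).
exists 1 => // r _.
have [tG|Gt] := ltP t G.
  exists ((G - t) / 2) => [|e T ee0 [? ? _ _ _]]; first by lra.
  by split => // _; lra.
exists 1 => // e T ee0 [? ? _ _ _]; split => // ?; lra.
Qed.

(** The value at T lies between the infimum and the infimum plus e; raising the level by the same e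
    makes the strict comparison exact, equality included. Thus the infimum is read off the past of
    T. *)
Lemma lim_scales_inf c : lim_scales [set p | forall q, scale_argmin j p x y q ->
  (((c + lag R p)%:E < x (q%:R * mesh R p))%E <->
   (c%:E < overall_inf x y)%E)].
Proof.
apply: (@lim_scales_argmin (fun r e T => ((c + e)%:E < x T)%E <->
  (c%:E < overall_inf x y)%E)).
exists 1 => // r _.
rewrite (overall_infK hxy hz z_gt0) -/I lte_fin.
have [cI|Ic] := ltP c I.
  exists (I - c) => [|e T ee0 [_ _ T0 _ _]]; first by lra.
  split => // _; apply: lt_le_trans (overall_inf_leE hxy hz z_gt0 T0).
  by rewrite -/I lte_fin; lra.
exists 1 => // e T ee0 [_ _ _ _ xT]; split => // cxT.
by have := lt_trans cxT xT; rewrite lte_fin; lra.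
Qed.

(** The lag puts T + t + e strictly after G + t and at distance less than 2e, where right continuity
    applies. *)
Lemma lim_scales_phase t : 0 <= t -> lim_scales [set p | forall q, scale_argmin j p x y q ->
  y (q%:R * mesh R p + (t + lag R p)) = y (G + t)].
Proof.
move=> t0; apply: (@lim_scales_argmin (fun r e T => y (T + (t + e)) = y (G + t))).
exists 1 => // r _.
have [G0 _ _ _] := inf_timeP hxy hz z_gt0; rewrite -/G in G0.
have [e e0 eP] := phase_right hxy (addr_ge0 G0 t0).
exists (e / 2) => [|e' T ee0 [? ? _ _ _]]; first by lra.
by apply: eP; lra.
Qed.

(** The increment tends to its limit with no control on the side, so a level equal to the limit
    value needs a margin r. The oscillation of the path after G + t is not bounded in terms of e, so
    r must be fixed first and e chosen afterwards. *)
Lemma lim_scales_increment t c : 0 <= t ->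
  lim_scales [set p | forall q, scale_argmin j p x y q ->
  (((c + level R p)%:E < x (q%:R * mesh R p + (t + lag R p))
     - x (q%:R * mesh R p))%E <->
   (c%:E < x (G + t) - overall_inf x y)%E)].
Proof.
move=> t0; apply: (@lim_scales_argmin (fun r e T =>
  ((c + r)%:E < x (T + (t + e)) - x T)%E <->
  (c%:E < x (G + t) - overall_inf x y)%E)).
have [G0 _ _ _] := inf_timeP hxy hz z_gt0; rewrite -/G in G0.
have Gt0 := addr_ge0 G0 t0.
rewrite (overall_infK hxy hz z_gt0) -/I.
have xT_fin e T : argmin_near_inf e T -> x T \is a fin_num.
  by move=> [_ _ T0 Tz _]; apply: (kc_fin hxy) => //; rewrite hz lte_fin.
have IT e T : argmin_near_inf e T -> I <= fine (x T).
  move=> /[dup] /xT_fin xTfin [_ _ T0 _ _].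
  by have := overall_inf_leE hxy hz z_gt0 T0; rewrite -[x T]fineK// lee_fin.
have Te e T : argmin_near_inf e T -> fine (x T) < I + e.
  by move=> /[dup] /xT_fin xTfin [_ _ _ _]; rewrite -lte_fin fineK.
(* If the path is dead at G + t, it is dead at T + t + e as well, because T + e > G; both increments
   are +oo. *)
have [zGt|Gtz] := leP z (G + t).
  exists 1 => // r _; exists 1 => // e T /andP[e0 _] Tnear.
  have [T1 T2 _ _ _] := Tnear.
  have [|-> _] := kc_dead hxy Gt0; first by rewrite hz lee_fin.
  have [||-> _] := kc_dead hxy (t := T + (t + e)); [lra|by rewrite hz lee_fin; lra|].
  by rewrite -(fineK (xT_fin _ _ Tnear)) !addye// !ltry.
have xGt_fin : x (G + t) \is a fin_num.
  by apply: (kc_fin hxy) => //; rewrite hz lte_fin.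
have near_right (g : R) : 0 < g -> exists2 e : R, 0 < e &
    forall s, G + t <= s < G + t + e -> x s \is a fin_num /\
      fine (x (G + t)) - g < fine (x s) < fine (x (G + t)) + g.
  move=> g0.
  have [||e1 e10 e1P] := path_right_gt hxy (t := G + t)
    (c := (fine (x (G + t)) - g)%:E) => //.
    by rewrite -[ltRHS]fineK// lte_fin; lra.
  have [||e2 e20 e2P] := path_right_lt hxy (t := G + t)
    (c := (fine (x (G + t)) + g)%:E) => //.
    by rewrite -[ltLHS]fineK// lte_fin; lra.
  exists (Num.min e1 e2) => [|s]; first by rewrite lt_min e10.
  have [m1 m2] : Num.min e1 e2 <= e1 /\ Num.min e1 e2 <= e2.
    by rewrite !ge_min !lexx !orbT.
  move=> sGt; have s1 : ((fine (x (G + t)) - g)%:E < x s)%E by apply: e1P; lra.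
  have s2 : (x s < (fine (x (G + t)) + g)%:E)%E by apply: e2P; lra.
  have xsfin : x s \is a fin_num.
    rewrite fin_numE; apply/andP; split.
      by rewrite -ltNye (lt_trans _ s1)// ltNyr.
    by rewrite -ltey (lt_trans s2)// ltry.
  by split=> //; rewrite -!lte_fin fineK// s1.
rewrite -(fineK xGt_fin) -EFinB lte_fin.
set v := fine (x (G + t)) in near_right *.
have [cv|vc] := ltP c (v - I).
  exists (v - I - c) => [|r /andP[r0 rv]]; first by lra.
  have [|e1 e10 e1P] := near_right ((v - I - c - r) / 2); first by lra.
  exists (Num.min (e1 / 2) ((v - I - c - r) / 2)) => [|e T]; first by rewrite lt_min; lra.
  rewrite lt_min => /and3P[e0 ee1 ev] Tnear; have [T1 T2 _ _ _] := Tnear.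
  have [|xsfin xs] := e1P (T + (t + e)); first by lra.
  have xTfin := xT_fin _ _ Tnear; have := Te _ _ Tnear.
  rewrite -(fineK xTfin) -(fineK xsfin) -EFinB lte_fin !fineK// => xT.
  by split=> // _; lra.
exists 1 => // r /andP[r0 _].
have [e1 e10 e1P] := near_right r r0.
exists (e1 / 2) => [|e T /andP[e0 ee1] Tnear]; first by lra.
have [T1 T2 _ _ _] := Tnear.
have [|xsfin xs] := e1P (T + (t + e)); first by lra.
have xTfin := xT_fin _ _ Tnear; have := IT _ _ Tnear.
rewrite -(fineK xTfin) -(fineK xsfin) -EFinB lte_fin !fineK// => xT.
by split=> // ?; lra.
Qed.

Lemma lim_scales_attained_phase : x G = overall_inf x y -> y G = Some j ->
  lim_scales [set p | forall q, scale_argmin j p x y q -> y (q%:R * mesh R p) = Some j].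
Proof.
move=> xG yG.
have [e0 e00 eP] := grid_argmin_phase_attained hxy hz z_gt0 xG yG.
apply: nearW => l.
apply: (@filterS _ (nbhs \oo) _ _ _ _ (near_infty_natSinv_lt (PosNum e00))) => k ke0.
by apply: (eP k.+1%:R^-1); rewrite ke0 invr_gt0 ltr0n.
Qed.

Lemma lim_scales_left_phase : (overall_inf x y < x G)%E ->
  lim_scales [set p | forall q, scale_argmin j p x y q ->
    y (q%:R * mesh R p) = left_phase y G].
Proof.
move=> IG.
have [e0 e00 eP] := grid_argmin_phase_left hxy hz z_gt0 j IG.
apply: nearW => l.
apply: (@filterS _ (nbhs \oo) _ _ _ _ (near_infty_natSinv_lt (PosNum e00))) => k ke0.
by apply: (eP k.+1%:R^-1); rewrite ke0 invr_gt0 ltr0n.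
Qed.

Lemma scale_argmin_ex (p : scales) : exists q, scale_argmin j p x y q.
Proof. by apply: (grid_argmin_ex hxy hz); rewrite // invr_gt0. Qed.

End limits_at_argmin.

(** * Measurability of the functionals of the path *)

Section measurable_quantifiers.
Context {d : measure_display} {T : measurableType d}.
Implicit Types (A B : T -> Prop) (Q : nat -> T -> Prop).

Lemma measurable_exists Q : (forall n, measurable [set w | Q n w]) ->
  measurable [set w | exists n, Q n w].
Proof.
move=> mQ; rewrite (_ : [set w | _] = \bigcup_n [set w | Q n w]).
  exact: bigcupT_measurable.
by apply/seteqP; split=> w [n]; [exists n|move=> _; exists n].
Qed.

Lemma measurable_forall Q : (forall n, measurable [set w | Q n w]) ->
  measurable [set w | forall n, Q n w].
Proof.
move=> mQ; rewrite (_ : [set w | _] = \bigcap_n [set w | Q n w]).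
  exact: bigcapT_measurable.
by apply/seteqP; split=> w Qw n; [move=> _; exact: Qw|exact: Qw].
Qed.

Lemma measurable_cst_prop (C : Prop) : measurable [set _ : T | C].
Proof.
have [c|nc] := pselect C.
  rewrite (_ : [set _ | _] = setT); first exact: measurableT.
  by apply/seteqP; split.
by rewrite (_ : [set _ | _] = set0)//; apply/seteqP; split.
Qed.

Lemma measurable_not A : measurable [set w | A w] -> measurable [set w | ~ A w].
Proof. exact: measurableC. Qed.

Lemma measurable_imply A B : measurable [set w | A w] ->
  measurable [set w | B w] -> measurable [set w | A w -> B w].
Proof.
move=> mA mB; rewrite (_ : [set w | _] = ~` [set w | A w] `|` [set w | B w]).
  by apply: measurableU => //; exact: measurableC.
apply/seteqP; split=> w /=; last by case=> // nA /nA.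
by move=> AB; have [/AB|] := pselect (A w); [right|left].
Qed.

Lemma measurable_true (b : T -> bool) : measurable_fun setT b ->
  measurable [set w | b w].
Proof.
by move=> mb; rewrite -[X in measurable X]setTI; exact: (mb measurableT [set true]).
Qed.

Lemma measurable_forall_grid (R : realType) (a b : T -> R) (B : R -> T -> Prop) :
  measurable_fun setT a -> measurable_fun setT b ->
  (forall s, 0 <= s -> measurable [set w | B s w]) ->
  measurable [set w | forall q m : nat,
    a w < q%:R * m.+1%:R^-1 < b w -> B (q%:R * m.+1%:R^-1) w].
Proof.
move=> ma mb mB.
apply: measurable_forall => q; apply: measurable_forall => m.
apply: measurable_imply; last by apply: mB; rewrite mulr_ge0// invr_ge0.
rewrite (_ : [set w | _] = [set w | a w < q%:R * m.+1%:R^-1] `&`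
                           [set w | q%:R * m.+1%:R^-1 < b w]).
  by apply: measurableI; apply: measurable_true; exact: measurable_fun_ltr.
by apply/seteqP; split=> w /= => [/andP[]|[-> ->]].
Qed.

End measurable_quantifiers.

(** * Descriptions of path properties by countably many grid times *)

Section killed_path_grid.
Context {R : realType} {E : finType} (x : R -> \bar R) (y : R -> option E).
Hypothesis hxy : killed_cadlag x y.
Implicit Types (s t a b : R).
Local Notation M := (lower_value x).

Lemma path_ge_grid (c : \bar R) a b t : 0 <= t ->
  (forall q m : nat, a < q%:R * m.+1%:R^-1 < b ->
    (c <= x (q%:R * m.+1%:R^-1))%E) ->
  a <= t -> t < b -> (c <= x t)%E.
Proof.
move=> t0 cx at_ tb; rewrite leNgt; apply/negP => /(path_right_lt hxy t0)[e e0 eP].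
have [||m _ /(_ m (leqnn m))[q /andP[tq qe]]] := @grid_point R t (Num.min b (t + e)) => //.
  by rewrite lt_min tb ltrDl.
move: qe; rewrite lt_min => /andP[qb qe].
have : (x (q%:R * m.+1%:R^-1) < c)%E by apply: eP; rewrite (ltW tq).
by apply/negP; rewrite -leNgt; apply: cx; rewrite qb (le_lt_trans at_).
Qed.

Lemma path_gt_gridP (c : R) t : 0 <= t ->
  (c%:E < x t)%E <-> exists n : nat, forall q m : nat,
    t < q%:R * m.+1%:R^-1 < t + n.+1%:R^-1 ->
    ((c + n.+1%:R^-1)%:E <= x (q%:R * m.+1%:R^-1))%E.
Proof.
move=> t0; split=> [cx|[n cx]]; last first.
  have n0 : 0 < n.+1%:R^-1 :> R by rewrite invr_gt0.
  have := path_ge_grid t0 cx (lexx t); rewrite ltrDl => /(_ n0).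
  by apply: lt_le_trans; rewrite lte_fin ltrDl.
have [c' cc' c'x] : exists2 c' : R, c < c' & (c'%:E < x t)%E.
  move: cx; case: (x t) => [v||//].
    by rewrite lte_fin => cv; exists ((c + v) / 2); rewrite ?lte_fin; lra.
  by exists (c + 1); rewrite ?ltry//; lra.
have [e e0 eP] := path_right_gt hxy t0 c'x.
have ec : 0 < Num.min e (c' - c) by rewrite lt_min e0/= subr_gt0.
have [n _ /(_ n (leqnn n))/=] := near_infty_natSinv_lt (PosNum ec).
rewrite lt_min => /andP[ne nc]; exists n => q m /andP[tq qn].
apply/ltW/(@le_lt_trans _ _ c'%:E); first by rewrite lee_fin -lerBrDl ltW.
by apply: eP; rewrite (ltW tq) (lt_trans qn)// ltrD2l.
Qed.

Lemma phase_gridP (i : option E) t : 0 <= t ->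
  y t = i <-> exists n : nat, forall q m : nat,
    t < q%:R * m.+1%:R^-1 < t + n.+1%:R^-1 -> y (q%:R * m.+1%:R^-1) = i.
Proof.
move=> t0; have [e e0 eP] := phase_right hxy t0.
split=> [yt|[n yn]].
  have [n _ /(_ n (leqnn n))/= ne] := near_infty_natSinv_lt (PosNum e0).
  exists n => q m /andP[tq qn].
  by rewrite eP// (ltW tq) (lt_trans qn)// ltrD2l.
have ne0 : 0 < Num.min e n.+1%:R^-1 by rewrite lt_min e0 invr_gt0 ltr0n.
have [||m _ /(_ m (leqnn m))[q]] := @grid_point R t (t + Num.min e n.+1%:R^-1) => //.
  by rewrite ltrDl.
rewrite -ltrBlDl lt_min => /and3P[tq qe qn].
by rewrite -(yn q m) ?eP// ?(ltW tq) ?tq/= -ltrBlDl.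
Qed.

Lemma left_phase_gridP (i : option E) t : 0 < t -> (t%:E <= lifetime y)%E ->
  left_phase y t = i <-> exists n : nat, forall q m : nat,
    t - n.+1%:R^-1 < q%:R * m.+1%:R^-1 < t -> y (q%:R * m.+1%:R^-1) = i.
Proof.
move=> t0 tz; have [e e0 eP] := phase_left hxy t0 tz.
split=> [yt|[n yn]].
  have [n _ /(_ n (leqnn n))/= ne] := near_infty_natSinv_lt (PosNum e0).
  exists n => q m /andP[tq qn].
  by rewrite eP// qn andbT; apply: lt_trans tq; rewrite ltrD2l ltrN2.
have ne0 : 0 < Num.min e (Num.min n.+1%:R^-1 t).
  by rewrite !lt_min e0 invr_gt0 ltr0n.
have [m1 m2 m3] : [/\ Num.min e (Num.min n.+1%:R^-1 t) <= e,
    Num.min e (Num.min n.+1%:R^-1 t) <= n.+1%:R^-1 &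
    Num.min e (Num.min n.+1%:R^-1 t) <= t].
  by rewrite !ge_min !lexx !orbT.
have [||m _ /(_ m (leqnn m))[q]] :=
  @grid_point R (t - Num.min e (Num.min n.+1%:R^-1 t)) t => //; [lra|lra|].
move: (yn q m) (eP (q%:R * m.+1%:R^-1)); set s := q%:R * _ => yns eps tq.
set h : R := n.+1%:R^-1 in yns m1 m2 m3 tq.
by rewrite -yns ?eps//; lra.
Qed.

Definition inf_times : set R := [set t : R | [/\ 0 <= t,
  (t%:E <= lifetime y)%E & M t = overall_inf x y]].

(** By compactness, having no infimum time on the segment means staying a uniform amount above the
    infimum on a slightly larger interval. By right continuity this can be tested on grid points.
    Infinite values of the infimum are treated apart. *)
Lemma inf_times_segmentP a b : 0 < a -> a <= b ->
  (forall t, a <= t <= b -> ~ inf_times t) <->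
  exists n : nat, forall q m : nat,
    a - n.+1%:R^-1 < q%:R * m.+1%:R^-1 < b + n.+1%:R^-1 ->
    (overall_inf x y + (n.+1%:R^-1)%:E <= x (q%:R * m.+1%:R^-1))%E.
Proof.
move=> a0 ab; split=> [nS|[n nP] t /andP[at_ tb] [t0 tz tI]]; last first.
  have n0 : 0 < n.+1%:R^-1 :> R by rewrite invr_gt0.
  set h : R := n.+1%:R^-1 in nP n0.
  have MI : (overall_inf x y + h%:E <= M t)%E.
    apply: (lower_value_ge hxy t0 n0) => s /andP[ts st] s0.
    by apply: (path_ge_grid s0 nP); lra.
  have := lower_value_gtNy hxy t0; rewrite tI.
  have : overall_inf x y != +oo%E.
    apply/negP => /eqP Ioo.
    have z0 : (0%:E < lifetime y)%E.
      by apply: lt_le_trans tz; rewrite lte_fin (lt_le_trans a0).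
    have := kc_fin hxy (lexx 0) z0.
    have := overall_inf_le hxy (lexx 0); rewrite Ioo leye_eq => /eqP ->.
    by [].
  move: MI; rewrite tI; case: (overall_inf x y) => // v.
  by rewrite lee_fin => + _ _; lra.
have MI t : a <= t <= b -> (overall_inf x y < M t)%E \/ overall_inf x y = +oo%E.
  move=> tab; have t0 : 0 <= t by lra.
  have [zt|tz] := ltP (lifetime y) t%:E.
    rewrite (lower_value_dead hxy)//; case: (overall_inf x y) => [v||]; [left|right|left] => //.
    by rewrite ltry.
  left; rewrite lt_neqAle (overall_inf_le_lower_value hxy t0) andbT.
  by apply/eqP => tI; apply: (nS t tab); split.
have x_ge (q m : nat) : (overall_inf x y <= x (q%:R * m.+1%:R^-1))%E.
  by apply: (overall_inf_le hxy); rewrite mulr_ge0// invr_ge0.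
move: x_ge MI; case: (overall_inf x y) => [v||] x_ge MI.
- have [t /MI[]//|e e0 eP] := lower_value_gt_segment (c := v) hxy (ltW a0) ab.
  have [n _ /(_ n (leqnn n))/= ne] := near_infty_natSinv_lt (PosNum e0).
  exists n => q m /andP[aq qb].
  apply: (@le_trans _ _ (v + e)%:E).
    by rewrite -EFinD lee_fin lerD2l ltW.
  apply: eP; last by rewrite mulr_ge0// invr_ge0.
  apply/andP; split; first by apply: lt_trans aq; rewrite ltrD2l ltrN2.
  by rewrite (lt_trans qb)// ltrD2l.
- exists 0%N => q m _; rewrite addye//; exact: x_ge.
- by exists 0%N => q m _; rewrite leNye.
Qed.

(** [sup] is 0 on a set that is empty or unbounded, so exceeding t >= 0 means boundedness together
    with a point beyond t. Both are phrased with compact segments having a positive left end, whence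
    N + 1 and t + 1/(n+1), as [inf_times_segmentP] requires. *)
Lemma inf_time_gtP t : 0 <= t -> t < inf_time x y <->
  (exists N : nat, forall p : nat,
    forall s, N.+1%:R <= s <= N.+1%:R + p%:R -> ~ inf_times s) /\
  (exists n : nat,
    ~ (forall s, t + n.+1%:R^-1 <= s <= t + n.+1%:R -> ~ inf_times s)).
Proof.
move=> t0; rewrite /inf_time -/inf_times; split.
  move=> tS; have Ssup : has_sup inf_times.
    by apply: contrapT => nS; move: tS; rewrite sup_out// ltNge t0.
  split.
    have [_ [u uS]] := Ssup; exists (Num.bound `|u|) => p s /andP[us _] /uS su.
    have : u < (Num.bound `|u|)%:R :=
      le_lt_trans (ler_norm u) (archi_boundP (normr_ge0 u)).
    have : (Num.bound `|u|)%:R < (Num.bound `|u|).+1%:R :> R by rewrite ltr_nat.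
    lra.
  have [s Ss ts] := sup_gt Ssup.1 tS.
  have st0 : 0 < s - t by rewrite subr_gt0.
  near \oo => n; exists n => /(_ s) []//; apply/andP; split.
    rewrite -lerBrDl ltW//.
    by near: n; exact: near_infty_natSinv_lt (PosNum st0).
  rewrite -lerBlDl -natr1 (@le_trans _ _ n%:R)//; last by rewrite lerDl.
  by near: n; exact: nbhs_infty_ger.
move=> [[N NS] [n /existsNP[s /not_implyP[/andP[ns _] /contrapT Ss]]]].
have n0 : 0 < n.+1%:R^-1 :> R by rewrite invr_gt0.
apply: (@lt_le_trans _ _ s); first by apply: lt_le_trans ns; rewrite ltrDl.
apply: ub_le_sup => //; exists N.+1%:R => u Su.
rewrite leNgt; apply/negP => Nu.
apply: (NS (Num.bound `|u|) u) => //; rewrite (ltW Nu)/=.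
apply: (le_trans (ler_norm u)); apply: (le_trans (ltW (archi_boundP (normr_ge0 u)))).
by rewrite lerDr.
Unshelve. all: by end_near. Qed.

End killed_path_grid.

Lemma inf_time_ge0 (R : realType) (E : finType) (x : R -> \bar R)
  (y : R -> option E) : 0 <= inf_time x y.
Proof.
have [Ssup|nS] := pselect (has_sup (inf_times x y)); last by rewrite /inf_time sup_out.
have [[t St] _] := Ssup; apply: (@le_trans _ _ t); first by case: St.
by apply: ub_le_sup => //; case: Ssup.
Qed.

Lemma inf_time_le_lifetime (R : realType) (E : finType) (x : R -> \bar R)
  (y : R -> option E) : 0 < inf_time x y -> ((inf_time x y)%:E <= lifetime y)%E.
Proof.
move=> G0; have Ssup : has_sup (inf_times x y).
  by apply: contrapT => nS; move: G0; rewrite /inf_time sup_out// ltxx.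
have [S0 _] := Ssup.
have : (0 <= lifetime y)%E.
  by apply: le_ereal_inf_tmp => _ [s [s0 _] <-]; rewrite lee_fin.
case Ez : (lifetime y) => [z| |]//; rewrite ?leey// => _.
rewrite lee_fin; apply: ge_sup => // t [_ + _].
by rewrite Ez lee_fin.
Qed.

Lemma measurable_fun_gt (R : realType) (d : measure_display)
    (T : measurableType d) (f : T -> \bar R) :
  (forall c : R, measurable [set w | (c%:E < f w)%E]) -> measurable_fun setT f.
Proof.
move=> mf; apply: (measurability _ (ErealGenOInfty.measurableE R)).
move=> _ [_ [c ->] <-]; rewrite setTI.
rewrite (_ : _ @^-1` _ = [set w | (c%:E < f w)%E])//.
by apply/seteqP; split=> w /=; rewrite in_itv/= andbT.
Qed.

Section measurable_path_functionals.
Context {R : realType} {E : finType} {d : measure_display}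
  {Omega : measurableType d} (X : Omega -> R -> \bar R)
  (J : Omega -> R -> option E).
Hypotheses
  (mX : forall t : R, 0 <= t -> measurable_fun setT (X ^~ t))
  (mJ : forall (t : R) (i : option E), 0 <= t -> measurable [set w | J w t = i])
  (cadlagXJ : forall w, killed_cadlag (X w) (J w)).

Lemma measurable_phase_grid (a b : Omega -> R) (i : option E) :
  measurable_fun setT a -> measurable_fun setT b ->
  measurable [set w | forall q m : nat,
    a w < q%:R * m.+1%:R^-1 < b w -> J w (q%:R * m.+1%:R^-1) = i].
Proof.
move=> ma mb; apply: (measurable_forall_grid (B := fun s w => J w s = i)) => //.
by move=> s s0; exact: mJ.
Qed.

Lemma measurable_ge_grid (a b : Omega -> R) (c : Omega -> \bar R) :
  measurable_fun setT a -> measurable_fun setT b -> measurable_fun setT c ->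
  measurable [set w | forall q m : nat,
    a w < q%:R * m.+1%:R^-1 < b w -> (c w <= X w (q%:R * m.+1%:R^-1))%E].
Proof.
move=> ma mb mc.
apply: (measurable_forall_grid (B := fun s w => (c w <= X w s)%E)) => //.
by move=> s s0; apply: measurable_true; apply: measurable_fun_lee => //; exact: mX.
Qed.

Lemma measurable_path_at (tau : Omega -> R) : measurable_fun setT tau ->
  (forall w, 0 <= tau w) -> measurable_fun setT (fun w => X w (tau w)).
Proof.
move=> mtau tau0; apply: measurable_fun_gt => c.
rewrite (_ : [set w | _] = [set w | exists n : nat, forall q m : nat,
    tau w < q%:R * m.+1%:R^-1 < tau w + n.+1%:R^-1 ->
    ((c + n.+1%:R^-1)%:E <= X w (q%:R * m.+1%:R^-1))%E]); last first.
  by apply/seteqP; split=> w /=; rewrite path_gt_gridP.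
apply: measurable_exists => n; apply: measurable_ge_grid => //.
by apply: measurable_funD.
Qed.

Lemma measurable_phase_at (tau : Omega -> R) (i : option E) :
  measurable_fun setT tau -> (forall w, 0 <= tau w) ->
  measurable [set w | J w (tau w) = i].
Proof.
move=> mtau tau0.
rewrite (_ : [set w | _] = [set w | exists n : nat, forall q m : nat,
    tau w < q%:R * m.+1%:R^-1 < tau w + n.+1%:R^-1 ->
    J w (q%:R * m.+1%:R^-1) = i]); last first.
  by apply/seteqP; split=> w /=; rewrite (phase_gridP (cadlagXJ w)).
apply: measurable_exists => n; apply: measurable_phase_grid => //.
exact: measurable_funD.
Qed.

Lemma measurable_overall_inf :
  measurable_fun setT (fun w => overall_inf (X w) (J w)).
Proof.
apply: (measurability _ (ErealGenCInfty.measurableE R)).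
move=> _ [_ [c ->] <-]; rewrite setTI.
rewrite (_ : _ @^-1` _ = [set w | forall q m : nat,
    (c%:E <= X w (q%:R * m.+1%:R^-1))%E]).
  apply: measurable_forall => q; apply: measurable_forall => m.
  apply: measurable_true; apply: measurable_fun_lee => //.
  by apply: mX; rewrite mulr_ge0// invr_ge0.
apply/seteqP; split=> w /=; rewrite in_itv/= andbT => cX.
  by move=> q m; apply: (le_trans cX); exact: overall_inf_le.
apply/(overall_inf_ge (cadlagXJ w)) => t t0.
apply: (@path_ge_grid _ _ _ _ (cadlagXJ w) _ t (t + 1)) => //.
by rewrite ltrDl.
Qed.

Lemma measurable_inf_time : measurable_fun setT (fun w => inf_time (X w) (J w)).
Proof.
have mseg (a b : R) : 0 < a -> a <= b -> measurable
    [set w | forall t, a <= t <= b -> ~ inf_times (X w) (J w) t].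
  move=> a0 ab.
  rewrite (_ : [set w | _] = [set w | exists n : nat, forall q m : nat,
    a - n.+1%:R^-1 < q%:R * m.+1%:R^-1 < b + n.+1%:R^-1 ->
    (overall_inf (X w) (J w) + (n.+1%:R^-1)%:E <=
     X w (q%:R * m.+1%:R^-1))%E]); last first.
    by apply/seteqP; split=> w /=; rewrite inf_times_segmentP.
  apply: measurable_exists => n.
  apply: (@measurable_ge_grid (cst (a - n.+1%:R^-1)) (cst (b + n.+1%:R^-1))) => //.
  by apply: emeasurable_funD => //; exact: measurable_overall_inf.
apply: (measurability _ (RGenOInfty.measurableE R)).
move=> _ [_ [t ->] <-]; rewrite setTI.
have [t0|t0] := ltP t 0.
  rewrite (_ : _ @^-1` _ = setT); first exact: measurableT.
  apply/seteqP; split=> w //= _; rewrite in_itv/= andbT.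
  exact: lt_le_trans t0 (inf_time_ge0 _ _).
rewrite (_ : _ @^-1` _ = [set w | exists N : nat, forall p : nat,
    forall s, N.+1%:R <= s <= N.+1%:R + p%:R -> ~ inf_times (X w) (J w) s] `&`
  [set w | exists n : nat, ~ (forall s, t + n.+1%:R^-1 <= s <= t + n.+1%:R ->
    ~ inf_times (X w) (J w) s)]); last first.
  apply/seteqP; split=> w /=; rewrite in_itv/= andbT.
    by move/(inf_time_gtP (X w) (J w) t0).
  by move=> ?; apply/inf_time_gtP.
apply: measurableI.
  apply: measurable_exists => N; apply: measurable_forall => p.
  by apply: mseg => //; rewrite lerDl.
apply: measurable_exists => n; apply: measurable_not; apply: mseg.
  by rewrite ltr_wpDl// invr_gt0.
rewrite lerD2l (@le_trans _ _ 1)// ?ler1n// invf_le1//.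
by rewrite ler1n.
Qed.

Lemma measurable_left_phase (j : E) :
  measurable [set w | left_phase (J w) (inf_time (X w) (J w)) = Some j].
Proof.
have mG := measurable_inf_time.
rewrite (_ : [set w | _] =
    ([set w | inf_time (X w) (J w) <= 0] `&` [set w | J w 0 = Some j]) `|`
    ([set w | 0 < inf_time (X w) (J w)] `&` [set w | exists n : nat,
       forall q m : nat, inf_time (X w) (J w) - n.+1%:R^-1 <
         q%:R * m.+1%:R^-1 < inf_time (X w) (J w) ->
       J w (q%:R * m.+1%:R^-1) = Some j])).
  apply: measurableU; apply: measurableI.
  - by apply: measurable_true; exact: measurable_fun_ler.
  - exact: mJ.
  - by apply: measurable_true; exact: measurable_fun_ltr.
  - apply: measurable_exists => n; apply: measurable_phase_grid => //.
    exact: measurable_funB.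
apply/seteqP; split=> w /=.
  have := inf_time_ge0 (X w) (J w); rewrite le_eqVlt => /predU1P[<-|G0].
    by rewrite /left_phase eqxx; left.
  rewrite (left_phase_gridP (cadlagXJ w)) ?inf_time_le_lifetime//.
  by right.
case=> [[Gle0]|[G0 Gn]].
  have -> : inf_time (X w) (J w) = 0.
    by apply/eqP; rewrite eq_le Gle0 inf_time_ge0.
  by rewrite /left_phase eqxx.
by rewrite (left_phase_gridP (cadlagXJ w)) ?inf_time_le_lifetime.
Qed.

End measurable_path_functionals.

(** * Path events and the Markov property *)

Definition path_rectangles (R : realType) (E : finType) : set (set (obs_path R E)) :=
  [set C | exists (t : R) (A : set (\bar R)) (j : option E), measurable A /\
     C = [set p | exists2 a, A a & p t = Some (a, j)]].

(** Path space as a measurable type whose measurable sets are the path events, so that the general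
    measurability lemmas apply to them. *)
Definition path_space (R : realType) (E : finType) :=
  g_sigma_algebraType (@path_rectangles R E).

Lemma path_event_coord (R : realType) (E : finType) (t : R) (A : set (\bar R))
    (K : set (option E)) : measurable A ->
  path_event [set p : obs_path R E |
    exists a i, [/\ A a, K i & p t = Some (a, i)]].
Proof.
move=> mA; rewrite (_ : [set p | _] = \bigcup_(i in K)
    [set p | exists2 a, A a & p t = Some (a, i)]); last first.
  apply/seteqP; split=> p /= => [[a [i [Aa Ki pt]]]|[i Ki [a Aa pt]]].
    by exists i => //; exists a.
  by exists a, i.
apply: (@fin_bigcup_measurable _ (path_space R E)); first exact: finite_finset.
by move=> i _; apply: sub_sigma_algebra; exists t, A, i.
Qed.

Lemma measurable_path_event (R : realType) (E : finType) (d : measure_display)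
    (T : measurableType d) (f : T -> obs_path R E) :
  (forall t A j, measurable A ->
    measurable [set w | exists2 a, A a & f w t = Some (a, j)]) ->
  forall B, path_event B -> measurable (f @^-1` B).
Proof.
move=> mf B mB; rewrite -[X in measurable X]setTI.
have mF : @measurable_fun _ _ T (path_space R E) setT f.
  apply: (@measurability _ _ T (path_space R E) setT f (@path_rectangles R E)) => //.
  by move=> _ [_ [t [A [j [mA ->]]]] <-]; rewrite setTI; exact: mf.
exact: mF.
Qed.

Section path_of_process.
Context {R : realType} {E : finType} {d : measure_display}
  {Omega : measurableType d} (X : Omega -> R -> \bar R)
  (J : Omega -> R -> option E).
Hypotheses
  (mX : forall t : R, 0 <= t -> measurable_fun setT (X ^~ t))
  (mJ : forall (t : R) (i : option E), 0 <= t -> measurable [set w | J w t = i])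
  (cadlagXJ : forall w, killed_cadlag (X w) (J w)).

Definition past (T : R) (w : Omega) : path_space R E :=
  observe `[0, T] (X w) (J w).

Definition future (T : R) (w : Omega) : path_space R E :=
  observe_from T (X w T) (X w) (J w).

Definition whole (w : Omega) : path_space R E := observe `[0, +oo[ (X w) (J w).

Definition past_event (T : R) : set (set Omega) :=
  @measurable _ (g_sigma_algebra_preimageType (past T)).

Lemma observeE (D : set R) (x : R -> \bar R) (y : R -> option E) t a i :
  observe D x y t = Some (a, i) <-> [/\ D t, x t = a & y t = i].
Proof.
rewrite /observe; split=> [|[/mem_set -> -> ->//]].
by case: ifPn => // /set_mem Dt [-> ->].
Qed.

Lemma measurable_past T : measurable_fun setT (past T).
Proof.
move=> _ B mB; rewrite setTI.
apply: (measurable_path_event _ mB) => t A j mA.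
rewrite (_ : [set w | _] = [set w | `[0, T]%classic t] `&`
    (X ^~ t @^-1` A `&` [set w | J w t = j])).
  have [t0|t0] := leP 0 t; last first.
    rewrite (_ : _ `&` _ = set0)//; apply/seteqP; split=> w //=.
    by rewrite in_itv/= leNgt t0 => -[].
  apply: measurableI; first exact: measurable_cst_prop.
  by apply: measurableI; [rewrite -[X in measurable X]setTI; exact: mX|exact: mJ].
apply/seteqP; split=> w /=.
  by move=> [a Aa /observeE[tT -> ->]].
move=> [tT [At Jt]]; exists (X w t) => //.
exact/observeE.
Qed.

Lemma past_event_measurable T S : past_event T S -> measurable S.
Proof. by move=> [B mB <-]; exact: (measurable_past T). Qed.

Lemma past_event_coord T t A i : 0 <= t <= T -> measurable A ->
  past_event T [set w | A (X w t) /\ J w t = i].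
Proof.
move=> tT mA; exists [set p | exists2 a, A a & p t = Some (a, i)].
  by apply: sub_sigma_algebra; exists t, A, i.
rewrite setTI; apply/seteqP; split=> w /=.
  by move=> [a Aa /observeE[_ -> ->]].
by move=> [At Jt]; exists (X w t) => //; apply/observeE.
Qed.

Lemma past_event_phase T t i : 0 <= t <= T -> past_event T [set w | J w t = i].
Proof.
move=> tT; rewrite (_ : [set w | _] = [set w | setT (X w t) /\ J w t = i]).
  exact: past_event_coord.
by apply/seteqP; split=> w //= [].
Qed.

Lemma past_measurable_path T t : 0 <= t <= T ->
  measurable_fun setT
    ((fun w => X w t) : g_sigma_algebra_preimageType (past T) -> \bar R).
Proof.
move=> tT _ A mA; rewrite setTI.
rewrite (_ : _ @^-1` _ = \bigcup_(i in [set: option E])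
    [set w | A (X w t) /\ J w t = i]).
  apply: fin_bigcup_measurable; first exact: finite_finset.
  by move=> i _; exact: past_event_coord.
apply/seteqP; split=> w /=; last by move=> [i _ []].
by move=> At; exists (J w t).
Qed.

Lemma measurable_observe_from (tau : Omega -> R) (c : Omega -> \bar R) B :
  measurable_fun setT tau -> (forall w, 0 <= tau w) -> measurable_fun setT c ->
  path_event B ->
  measurable [set w | B (observe_from (tau w) (c w) (X w) (J w))].
Proof.
move=> mtau tau0 mc mB.
apply: (measurable_path_event _ mB) => t A j mA.
have [t0|t0] := leP 0 t; last first.
  rewrite (_ : [set w | _] = set0)//; apply/seteqP; split=> w //=.
  by move=> [a _ /observeE[]]; rewrite /= in_itv/= andbT leNgt t0.
have mtaut : measurable_fun setT (fun w => tau w + t) by exact: measurable_funD.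
have taut0 w : 0 <= tau w + t by rewrite addr_ge0.
rewrite (_ : [set w | _] = (fun w => X w (tau w + t) - c w)%E @^-1` A `&`
    [set w | J w (tau w + t) = j]).
  apply: measurableI; last exact: measurable_phase_at.
  rewrite -[X in measurable X]setTI; apply: emeasurable_funB => //.
  exact: measurable_path_at.
apply/seteqP; split=> w /=.
  by move=> [a Aa /observeE[_ -> ->]].
move=> [At Jt]; exists (X w (tau w + t) - c w)%E => //.
by apply/observeE; rewrite /= in_itv/= t0.
Qed.

Lemma measurable_future T B : 0 <= T -> path_event B -> measurable (future T @^-1` B).
Proof.
by move=> T0; apply: (@measurable_observe_from (cst T)) => //; exact: mX.
Qed.

Lemma measurable_whole B : path_event B -> measurable (whole @^-1` B).
Proof.
move=> mB; apply: (measurable_path_event _ mB) => t A j mA.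
have [t0|t0] := leP 0 t; last first.
  rewrite (_ : [set w | _] = set0)//; apply/seteqP; split=> w //=.
  by move=> [a _ /observeE[]]; rewrite /= in_itv/= andbT leNgt t0.
rewrite (_ : [set w | _] = X ^~ t @^-1` A `&` [set w | J w t = j]).
  by apply: measurableI; [rewrite -[X in measurable X]setTI; exact: mX|exact: mJ].
apply/seteqP; split=> w /=.
  by move=> [a Aa /observeE[_ -> ->]].
move=> [At Jt]; exists (X w t) => //.
by apply/observeE; rewrite /= in_itv/= t0.
Qed.

Lemma dead_mono w s t : 0 <= s -> s <= t -> J w s = None -> J w t = None.
Proof.
move=> s0 st Js; have [|//] := kc_dead (cadlagXJ w) (le_trans s0 st).
apply: (@le_trans _ _ s%:E); last by rewrite lee_fin.
by apply: ereal_inf_lbound; exists s.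
Qed.

Lemma lifetime_pinftyP w :
  lifetime (J w) = +oo%E <-> forall n : nat, J w n%:R <> None.
Proof.
split=> [zoo n|Jn].
  by apply: alive_phase => //; rewrite zoo ltry.
apply/ereal_inf_pinfty => _ [t [t0 Jt] <-]; exfalso.
apply: (Jn (Num.bound t)); apply: (dead_mono t0 _ Jt).
exact/ltW/archi_boundP.
Qed.

End path_of_process.

(** * The Markov property at a fixed time and the almost sure finiteness of the life time *)

Lemma le_measure_phases (R : realType) (d : measure_display)
    (T : measurableType d) (mu : probability T R) (E : finType)
    (f : T -> option E) (N : set T) (b : \bar R) :
  (forall i, measurable [set w | f w = i]) -> measurable N ->
  (forall i, mu ([set w | f w = Some i] `&` N) <= b * mu [set w | f w = Some i])%E ->
  (mu ([set w | f w <> None] `&` N) <= b * mu [set w | f w <> None])%E.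
Proof.
move=> mf mN fN; pose A (s : seq E) := [set w | exists2 i, i \in s & f w = Some i].
have AE : [set w | f w <> None] = A (enum E).
  apply/seteqP; split=> w /=; last by case=> i _ ->.
  by case fw : (f w) => [i|//] _; exists i; rewrite ?mem_enum.
suff AP s : measurable (A s) /\ (mu (A s `&` N) <= b * mu (A s))%E.
  by rewrite AE; have [] := AP (enum E).
elim: s => [|i s [mA IH]].
  have -> : A [::] = set0 by apply/seteqP; split=> w // [].
  by rewrite set0I measure0 mule0.
have [si|si] := boolP (i \in s).
  have -> : A (i :: s) = A s; last by [].
  apply/seteqP; split=> w [j]; last by move=> js fw; exists j => //; rewrite inE js orbT.
  by rewrite inE => /predU1P[->|js] fw; [exists i|exists j].
have mi : measurable [set w | f w = Some i] by exact: mf.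
have Ais : A (i :: s) = [set w | f w = Some i] `|` A s.
  apply/seteqP; split=> w /=.
    by move=> [j]; rewrite inE => /predU1P[->|js] fw; [left|right; exists j].
  by case=> [fw|[j js fw]]; [exists i|exists j] => //; rewrite inE ?eqxx// js orbT.
have disj : [set w | f w = Some i] `&` A s = set0.
  apply/seteqP; split=> w //= [fw [j js]]; rewrite fw => -[ij].
  by rewrite ij js in si.
rewrite Ais; split; first exact: measurableU.
rewrite setIUl !measureU//.
- by have := leeD (fN i) IH; rewrite -ge0_muleDr.
- exact: measurableI.
- exact: measurableI.
- by rewrite setIACA disj set0I.
Qed.

Section markov.
Context {R : realType} {E : finType} {d : measure_display}
  {Omega : measurableType d} (P : E -> probability Omega R)
  (X : Omega -> R -> \bar R) (J : Omega -> R -> option E).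
Hypothesis hMAP : killed_MAP P X J.
Let mX := map_X_meas hMAP.
Let mJ := map_J_meas hMAP.
Let cadlagXJ := map_cadlag hMAP.

(** Combines [map_indep] and [map_law]. In product form, without conditioning, the identity also
    covers phases of probability zero at time T, where both sides vanish. *)
Lemma markov_split (k i : E) (T : R) (S : set Omega) (B : set (obs_path R E)) :
  0 <= T -> past_event X J T S -> path_event B ->
  (P k (S `&` [set w | J w T = Some i] `&` future X J T @^-1` B) =
   P k (S `&` [set w | J w T = Some i]) * P i (whole X J @^-1` B))%E.
Proof.
move=> T0 pS mB; set H := [set w | J w T = Some i].
have mH : measurable H by exact: mJ.
have mS := past_event_measurable mX mJ pS.
have mZ : measurable (future X J T @^-1` B) by exact: (measurable_future mX mJ cadlagXJ).
have mW : measurable (whole X J @^-1` B) by exact: (measurable_whole mX mJ).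
have mSH := measurableI _ _ mS mH.
have mSHZ := measurableI _ _ mSH mZ.
have fP j A : measurable A -> P j A \is a fin_num by exact: fin_num_measure.
have [H0|H0] := eqVneq (P k H) 0%E.
  rewrite (subset_measure0 mSHZ mH)//; last by move=> w [[]].
  by rewrite (subset_measure0 mSH mH) ?mul0e//; move=> w [].
have Hgt0 : (0 < P k H)%E by rewrite lt_neqAle eq_sym H0 measure_ge0.
have h0 : fine (P k H) != 0 by rewrite fine_eq0// fP.
case: pS => A mA; rewrite setTI => SA.
have := map_indep hMAP T0 Hgt0 mA mB; rewrite /cprob.
have -> : (fun w => observe `[0, T] (X w) (J w)) @^-1` A = S by rewrite -SA.
have := map_law hMAP T0 Hgt0 mB; rewrite /cprob => ->.
rewrite (setIC S) -setIA -/H => /(congr1 (fun u => u * fine (P k H))).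
rewrite divfK// mulrAC divfK// => e.
rewrite -(fineK (fP k _ mSHZ)) -(fineK (fP k _ mSH)) -(fineK (fP i _ mW)) -EFinM.
by congr EFin; rewrite -e; congr (fine (P k _)); rewrite setIC.
Qed.

Lemma path_event_phase t i : path_event [set p : obs_path R E | exists a, p t = Some (a, i)].
Proof.
apply: sub_sigma_algebra; exists t, setT, i; split; first exact: measurableT.
by apply/seteqP; split=> p /= [a]; exists a.
Qed.

Lemma whole_phaseP w t i : 0 <= t ->
  (exists a, whole X J w t = Some (a, i)) <-> J w t = i.
Proof.
move=> t0; split=> [[a /observeE[_ _ ->]]//|Jt].
by exists (X w t); apply/observeE; rewrite /= in_itv/= t0.
Qed.

Lemma future_phaseP w T t i : 0 <= t ->
  (exists a, future X J T w t = Some (a, i)) <-> J w (T + t) = i.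
Proof.
move=> t0; split=> [[a /observeE[_ _ ->]]//|Jt].
by exists (X w (T + t) - X w T)%E; apply/observeE; rewrite /= in_itv/= t0.
Qed.

Hypotheses (hirr : irreducible_phase P J) (q : E -> R)
  (hq : killing_rates P J q) (hq0 : exists i : E, q i != 0).

(** If killing from [i0] had probability zero at every time, the quotients defining [q i0] would
    vanish, against [q i0 != 0]. Irreducibility leads from i to [i0], and the Markov property chains
    the two events. *)
Lemma killed_with_positive_probability (i : E) :
  exists2 t : R, 0 <= t & (0 < P i [set w | J w t = None])%E.
Proof.
have [i0 qi0] := hq0.
have [t t0 kt] : exists2 t : R, 0 <= t & (0 < P i0 [set w | J w t = None])%E.
  apply: contrapT => nt; move: qi0 => /eqP; apply.
  have q0 : fine (P i0 [set w | J w t = None]) / t @[t --> (0 : R)^'+] --> (0 : R);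
    last by have /(_ i0) qc := hq; rewrite -(cvg_lim _ qc)// (cvg_lim _ q0).
  apply: cvg_near_cst; apply/near_at_rightP; exists 1 => // t /andP[t0 _].
  have -> : P i0 [set w | J w t = None] = 0%E.
    apply/eqP; rewrite eq_le measure_ge0 andbT leNgt; apply/negP => kt.
    by apply: nt; exists t => //; exact: ltW.
  by rewrite mul0r.
have [s s0 Js] := hirr i i0.
exists (s + t); first exact: addr_ge0.
have := markov_split i i0 s0 (S := setT)
  (B := [set p | exists a, p t = Some (a, None)]).
rewrite setTI => /(_ _ (path_event_phase t None)) Hsplit.
have mt : measurable [set w | J w (s + t) = None] by apply: mJ; exact: addr_ge0.
apply: (@lt_le_trans _ _ (P i ([set w | J w s = Some i0] `&`
   future X J s @^-1` [set p | exists a, p t = Some (a, None)]))).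
  rewrite Hsplit; last exact: measurableT.
  rewrite mule_gt0// (_ : whole X J @^-1` _ = [set w | J w t = None])//.
  by apply/seteqP; split=> w; rewrite /= whole_phaseP.
apply: le_measure; rewrite ?inE//.
  apply: measurableI; first exact: mJ.
  by apply: (measurable_future mX mJ cadlagXJ) => //; exact: path_event_phase.
by move=> w [_] /=; rewrite future_phaseP.
Qed.

Let immortal := [set w | lifetime (J w) = +oo%E].
(** Death is absorbing, so integer times suffice and immortality becomes a path event. *)
Let immortal_path : set (obs_path R E) :=
  [set p | forall n : nat, ~ exists a, p n%:R = Some (a, None)].

Lemma path_event_immortal : path_event immortal_path.
Proof.
apply: (@measurable_forall _ (path_space R E)
  (fun n p => ~ exists a, p n%:R = Some (a, None))) => n.
by apply: (@measurable_not _ (path_space R E)); exact: path_event_phase.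
Qed.

Lemma whole_immortal : whole X J @^-1` immortal_path = immortal.
Proof.
apply/seteqP; split=> w /=.
  move=> nJ; apply/(lifetime_pinftyP cadlagXJ) => n Jn.
  by apply: (nJ n); apply/whole_phaseP.
by move=> /(lifetime_pinftyP cadlagXJ) nJ n; rewrite whole_phaseP.
Qed.

Lemma measurable_immortal : measurable immortal.
Proof. by rewrite -whole_immortal; apply: (measurable_whole mX mJ); exact: path_event_immortal. Qed.

Lemma immortal_markov (k : E) (T : R) (b : \bar R) : 0 <= T ->
  (forall i, P i immortal <= b)%E ->
  (P k immortal <= b * P k [set w | J w T <> None])%E.
Proof.
move=> T0 Pb; have mI := measurable_immortal.
have immortal_alive w : immortal w -> J w T <> None.
  by move=> Iw; apply: alive_phase => //; rewrite Iw ltry.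
have -> : immortal = [set w | J w T <> None] `&` immortal.
  by apply/seteqP; split=> w; [move=> Iw; split=> //; exact: immortal_alive|case].
apply: le_measure_phases => //; first by move=> i; exact: mJ.
move=> i; have := @markov_split k i T setT immortal_path T0.
rewrite !setTI => /(_ _ path_event_immortal) split.
apply: (@le_trans _ _ (P k [set w | J w T = Some i] * P i immortal)%E); last first.
  by rewrite muleC lee_pmul.
rewrite -whole_immortal -split; last exact: measurableT.
apply: le_measure; rewrite ?inE.
- by apply: measurableI => //; [exact: mJ|rewrite whole_immortal].
- apply: measurableI; first exact: mJ.
  by apply: (measurable_future mX mJ cadlagXJ) => //; exact: path_event_immortal.
- rewrite whole_immortal => w [Ji Iw]; split=> // n [a /observeE[]].
  rewrite /= in_itv/= => _ _; have : J w (T + n%:R) <> None.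
    by apply: alive_phase; rewrite ?Iw ?ltry// addr_ge0.
  by [].
Qed.

(** A maximum principle: let g be the largest probability of immortality, reached from i. The Markov
    property at a time T where death from i has probability c > 0 gives g <= g (1 - c), hence g =
    0. *)
Lemma immortal_negligible (k : E) : P k immortal = 0%E.
Proof.
have mI := measurable_immortal.
have fI i : P i immortal \is a fin_num by exact: fin_num_measure.
pose g i := fine (P i immortal).
have [i _ ig] := @arg_maxP _ R E k xpredT g isT.
have {}ig i' : (P i' immortal <= (g i)%:E)%E.
  by rewrite -(fineK (fI i')) lee_fin; exact: ig.
have [T T0 kT] := killed_with_positive_probability i.
have mT := mJ None T0.
have fT : P i [set w | J w T = None] \is a fin_num by exact: fin_num_measure.
have := immortal_markov i T0 ig.
have -> : [set w | J w T <> None] = ~` [set w | J w T = None] by [].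
rewrite probability_setC// -(fineK fT) -(fineK (fI i)) -/(g i) -EFinB -EFinM lee_fin.
have g0 : 0 <= g i by rewrite fine_ge0.
have c0 : 0 < fine (P i [set w | J w T = None]).
  by rewrite fine_gt0// kT/= ltey_eq fT.
move=> gg; have gi0 : g i = 0 by nra.
by apply/eqP; rewrite eq_le measure_ge0 andbT (le_trans (ig k))// gi0.
Qed.

Definition mortal_path (w : Omega) : Prop :=
  exists2 z : R, 0 < z & lifetime (J w) = z%:E.

Lemma mortal_path_full (k : E) : exists N : set Omega,
  [/\ measurable N, P k N = 0%E & forall w, ~ N w -> mortal_path w].
Proof.
have m0 : measurable [set w | J w 0 = None] by exact: mJ.
exists (immortal `|` [set w | J w 0 = None]); split.
- by apply: measurableU => //; exact: measurable_immortal.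
- have J0 : P k [set w | J w 0 = None] = 0%E.
    have mk : measurable [set w | X w 0 = 0%E /\ J w 0 = Some k].
      apply: measurableI; last exact: mJ.
      rewrite -[X in measurable X]setTI.
      exact: (mX (lexx 0) measurableT (emeasurable_set1 0%E)).
    have := probability_setC (P k) mk; rewrite (map_start hMAP) subee// => mk0.
    apply: (subset_measure0 m0 (measurableC mk) _ mk0).
    by move=> w /= -> [].
  apply/eqP; rewrite eq_le measure_ge0 andbT.
  apply: le_trans (measureU2 (P k) measurable_immortal m0) _.
  suff : (P k immortal + P k [set w | J w 0%R = None] <= 0)%E by [].
  by rewrite immortal_negligible J0 adde0.
- move=> w /not_orP[nI J0]; rewrite /mortal_path.
  have : (0 < lifetime (J w))%E.
    rewrite ltNge; apply/negP => z0.
    by have [] := kc_dead (cadlagXJ w) (lexx 0) z0.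
  move: nI; rewrite /immortal/=; case: (lifetime (J w)) => [z _|//|_//].
  by rewrite lte_fin => z0; exists z.
Qed.

End markov.

(** * Splitting at the argmin and passage to the limit *)

(** The identity is linear in F, hence kept by proper differences and increasing limits; the
    hypothesis is its instance at the whole space. *)
Lemma lambda_system_proportional (R : realType) (d : measure_display)
    (T : measurableType d) (mu : probability T R) (C D : set T) (u v : R) :
  measurable C -> measurable D -> fine (mu C) * u = fine (mu D) * v ->
  lambda_system setT [set F | measurable F /\
    fine (mu (F `&` C)) * u = fine (mu (F `&` D)) * v].
Proof.
move=> mC mD CD.
have fmu A : measurable A -> mu A \is a fin_num by exact: fin_num_measure.
split => //.
- by split; [exact: measurableT|rewrite !setTI].
- move=> A B BA [mA eA] [mB eB]; split; first exact: measurableD.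
  have muD K : measurable K ->
      fine (mu ((A `\` B) `&` K)) = fine (mu (A `&` K)) - fine (mu (B `&` K)).
    move=> mK; have mBK := measurableI _ _ mB mK.
    have mABK := measurableI _ _ (measurableD mA mB) mK.
    have -> : A `&` K = (A `\` B) `&` K `|` B `&` K.
      apply/seteqP; split=> w /= [].
        by move=> Aw Kw; have [Bw|nBw] := pselect (B w); [right|left].
      - by move=> [[]].
      - by move=> [/BA].
    rewrite measureU// ?fineD ?fmu ?addrK//.
    by apply/seteqP; split=> w //= [[[]]] + + + [].
  by rewrite !muD// !mulrBl eA eB.
- move=> F ndF FP; split; first by apply: bigcupT_measurable => n; case: (FP n).
  have cvgF K : measurable K ->
      fine (mu (F n `&` K)) @[n --> \oo] --> fine (mu (\bigcup_n F n `&` K)).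
    move=> mK; apply: fine_cvg; rewrite fineK; last first.
      apply: fmu; apply: measurableI => //.
      by apply: bigcupT_measurable => n; case: (FP n).
    rewrite setI_bigcupl; apply: nondecreasing_cvg_mu.
    - by move=> n; apply: measurableI => //; case: (FP n).
    - by apply: bigcupT_measurable => n; apply: measurableI => //; case: (FP n).
    - by move=> n m nm; apply/subsetPset; apply: setSI; apply/subsetPset; exact: ndF.
  have cC : fine (mu (F n `&` C)) * u @[n --> \oo] -->
      fine (mu (\bigcup_n F n `&` C)) * u.
    by apply: cvgM; [exact: cvgF|exact: cvg_cst].
  have cD : fine (mu (F n `&` D)) * v @[n --> \oo] -->
      fine (mu (\bigcup_n F n `&` D)) * v.
    by apply: cvgM; [exact: cvgF|exact: cvg_cst].
  rewrite -(cvg_lim _ cC)// -(cvg_lim _ cD)//.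
  by congr (lim (_ @ \oo)); apply/funext => n; case: (FP n).
Qed.

Lemma past_eventI (R : realType) (E : finType) (d : measure_display)
    (Omega : measurableType d) (X : Omega -> R -> \bar R)
    (J : Omega -> R -> option E) T A B :
  past_event X J T A -> past_event X J T B -> past_event X J T (A `&` B).
Proof. exact: (@measurableI _ (g_sigma_algebra_preimageType (past X J T))). Qed.

Lemma path_eventI (R : realType) (E : finType) (A B : set (obs_path R E)) :
  path_event A -> path_event B -> path_event (A `&` B).
Proof. exact: (@measurableI _ (path_space R E)). Qed.

Section factorization.
Context {R : realType} {E : finType} {d : measure_display}
  {Omega : measurableType d} (P : E -> probability Omega R)
  (X : Omega -> R -> \bar R) (J : Omega -> R -> option E).
Hypothesis hMAP : killed_MAP P X J.
Variable j : E.
Let mX := map_X_meas hMAP.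
Let mJ := map_J_meas hMAP.
Let cadlagXJ := map_cadlag hMAP.

Definition argmin_past (p : scales) (q : nat) : set Omega := [set w |
  forall l, (l < q)%N ->
    (perturbed j p.2.2.1.+1%:R^-1 (lag R p / 2) (X w) (J w) (q%:R * mesh R p) <=
     perturbed j p.2.2.1.+1%:R^-1 (lag R p / 2) (X w) (J w) (l%:R * mesh R p))%E].

(* On {J_T = j} the future (X_(T+t) - X_T, J_(T+t)) alone tells whether the
   perturbed path stays above its value at T: the bonus for phase j at time T
   is known. *)
Definition argmin_future (p : scales) : set (obs_path R E) := [set f |
  forall n : nat, exists a i,
    ((p.2.2.1.+1%:R^-1 * (n.+1%:R * mesh R p +
        lag R p / 2 * ((i == Some j)%:R - 1)))%:E < a)%E /\
    f (n.+1%:R * mesh R p) = Some (a, i)].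

Lemma mesh_ge0 p : 0 <= mesh R p.
Proof. by rewrite invr_ge0. Qed.

Lemma past_event_argmin p q : past_event X J (q%:R * mesh R p) (argmin_past p q).
Proof.
set T := q%:R * mesh R p.
have mp l : (l <= q)%N -> measurable_fun setT
  ((fun w => perturbed j p.2.2.1.+1%:R^-1 (lag R p / 2) (X w) (J w)
     (l%:R * mesh R p)) : g_sigma_algebra_preimageType (past X J T) -> \bar R).
  move=> lq; have lT : 0 <= l%:R * mesh R p <= T.
    by rewrite mulr_ge0 ?mesh_ge0//= ler_wpM2r ?mesh_ge0// ler_nat.
  apply: emeasurable_funB; first exact: past_measurable_path.
  apply/measurable_EFinP; apply: measurable_funM => //.
  apply: measurable_funD => //; apply: measurable_funM => //.
  rewrite (_ : (fun w => _) =
    (fun w => if J w (l%:R * mesh R p) == Some j then 1 else 0)); last first.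
    by apply/funext => w; case: eqP.
  apply: measurable_fun_ifT => //.
  apply: (measurable_fun_bool true); rewrite setTI.
  rewrite (_ : _ @^-1` _ = [set w | J w (l%:R * mesh R p) = Some j]).
    exact: past_event_phase.
  by apply/seteqP; split=> w /= /eqP.
apply: measurable_forall => l.
have [lq|ql] := ltnP l q; last first.
  rewrite (_ : [set w | _] = setT); first exact: measurableT.
  by apply/seteqP; split=> w.
rewrite (_ : [set w | _] = [set w |
    (perturbed j p.2.2.1.+1%:R^-1 (lag R p / 2) (X w) (J w) (q%:R * mesh R p) <=
     perturbed j p.2.2.1.+1%:R^-1 (lag R p / 2) (X w) (J w) (l%:R * mesh R p))%E]).
  apply: measurable_true; apply: measurable_fun_lee; apply: mp => //.
  exact: ltnW.
by apply/seteqP; split=> w /= => [/(_ isT)|].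
Qed.

Lemma path_event_argmin p : path_event (argmin_future p).
Proof.
apply: (@measurable_forall _ (path_space R E)
  (fun n f => exists a i, ((p.2.2.1.+1%:R^-1 * (n.+1%:R * mesh R p +
        lag R p / 2 * ((i == Some j)%:R - 1)))%:E < a)%E /\
    f (n.+1%:R * mesh R p) = Some (a, i))) => n.
rewrite (_ : [set f | _] = \bigcup_(i in [set: option E])
  [set f : obs_path R E | exists a i', [/\ `]((p.2.2.1.+1%:R^-1 * (n.+1%:R * mesh R p +
        lag R p / 2 * ((i == Some j)%:R - 1)))%:E), +oo[%classic a, i' = i &
    f (n.+1%:R * mesh R p) = Some (a, i')]]); last first.
  apply/seteqP; split=> f /=.
    by move=> [a [i [ai fa]]]; exists i => //; exists a, i; rewrite in_itv/= ai.
  by move=> [i _ [a [_ [+ -> fa]]]]; rewrite in_itv/= andbT => ai; exists a, i.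
apply: (@fin_bigcup_measurable _ (path_space R E)); first exact: finite_finset.
move=> i _; apply: (@path_event_coord R E _ _ [set i]).
exact: emeasurable_itv.
Qed.

(** In the comparison of the perturbed path at T and T + s, the drift up to T cancels and the bonus
    at T is the known constant delta kappa. What remains is a condition on the increment and the
    phase after s; this is the exact splitting on the grid. *)
Lemma scale_argminP p q w : J w (q%:R * mesh R p) = Some j ->
  scale_argmin j p (X w) (J w) q <->
  argmin_past p q w /\ argmin_future p (future X J (q%:R * mesh R p) w).
Proof.
move=> Jq; set T := q%:R * mesh R p.
have T0 : 0 <= T by rewrite mulr_ge0 ?mesh_ge0.
have xfin : X w T \is a fin_num.
  by apply: (kc_fin (cadlagXJ w)) => //; apply: (phase_alive (cadlagXJ w)); rewrite // Jq.
set dl : R := p.2.2.1.+1%:R^-1; set kp := lag R p / 2.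
have step (n : nat) : (perturbed j dl kp (X w) (J w) T <
    perturbed j dl kp (X w) (J w) (T + n.+1%:R * mesh R p))%E <->
  ((dl * (n.+1%:R * mesh R p +
     kp * ((J w (T + n.+1%:R * mesh R p) == Some j)%:R - 1)))%:E <
   X w (T + n.+1%:R * mesh R p) - X w T)%E.
  rewrite /perturbed Jq eqxx; set s := n.+1%:R * mesh R p.
  have s0 : 0 <= T + s by rewrite addr_ge0// mulr_ge0 ?mesh_ge0.
  have := path_gtNy (cadlagXJ w) s0; rewrite -(fineK xfin).
  set v : R := (_ == _)%:R.
  case: (X w (T + s)) => [xs _|_|//]; last by rewrite addye// ?ltry.
  rewrite -!EFinB !lte_fin; set xT := fine _.
  have -> : dl * (T + kp * 1%:R) = dl * T + dl * kp by rewrite mulrDr mulr1.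
  have -> : dl * (T + s + kp * v) = dl * T + dl * s + dl * kp * v.
    by rewrite !mulrDr mulrA.
  have -> : dl * (s + kp * (v - 1)) = dl * s + dl * kp * v - dl * kp.
    by rewrite mulrDr mulrBr mulr1 mulrBr mulrA addrA.
  by split=> ?; lra.
have TE n : T + n.+1%:R * mesh R p = (q + n.+1)%:R * mesh R p.
  by rewrite natrD mulrDl.
split=> [[q1 q2]|[q1 q2]].
  split=> // n; exists (X w (T + n.+1%:R * mesh R p) - X w T)%E.
  exists (J w (T + n.+1%:R * mesh R p)); split.
    by apply/step; rewrite TE; apply: q2; rewrite addnS ltnS leq_addr.
  by apply/observeE; split=> //; rewrite /= in_itv/= mulr_ge0 ?mesh_ge0.
split=> // l ql; have [a [i [ai /observeE[_ ae ie]]]] := q2 (l - q.+1)%N.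
have := step (l - q.+1)%N; rewrite TE -subSn// subSS subnKC 1?ltnW//.
move=> [_]; apply; move: ai; rewrite -ae -ie TE.
by rewrite -subSn// subSS subnKC 1?ltnW.
Qed.

Definition splitting_event (p : scales) (F : nat -> set Omega)
    (B : set (obs_path R E)) : set Omega := [set w | exists q : nat,
  [/\ scale_argmin j p (X w) (J w) q, J w (q%:R * mesh R p) = Some j, F q w &
      B (future X J (q%:R * mesh R p) w)]].

Lemma scale_argmin_inj p (x : R -> \bar R) (y : R -> option E) q q' :
  scale_argmin j p x y q -> scale_argmin j p x y q' -> q = q'.
Proof.
move=> [p1 p2] [p1' p2'].
have [qq'|q'q|//] := ltngtP q q'.
  by have := lt_le_trans (p2 _ qq') (p1' _ qq'); rewrite ltxx.
by have := lt_le_trans (p2' _ q'q) (p1 _ q'q); rewrite ltxx.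
Qed.

Let term p (F : nat -> set Omega) B q : set Omega :=
  (F q `&` argmin_past p q) `&` [set w | J w (q%:R * mesh R p) = Some j] `&`
  future X J (q%:R * mesh R p) @^-1` (argmin_future p `&` B).

Lemma splitting_eventE p F B : splitting_event p F B = \bigcup_q term p F B q.
Proof.
apply/seteqP; split=> w.
  move=> [q [qmin Jq Fq Bq]]; exists q => //.
  by have [/(_ qmin)[? ?] _] := scale_argminP Jq; split.
move=> [q _ [[[Fq pq] Jq] [fq Bq]]]; exists q; split=> //.
exact/(scale_argminP Jq).
Qed.

Lemma measurable_term p F B q :
  past_event X J (q%:R * mesh R p) (F q) -> path_event B ->
  measurable (term p F B q).
Proof.
move=> pF mB; have qh0 : 0 <= q%:R * mesh R p by rewrite mulr_ge0 ?mesh_ge0.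
apply: measurableI; first apply: measurableI.
- apply: (past_event_measurable mX mJ (T := q%:R * mesh R p)).
  by apply: past_eventI => //; exact: past_event_argmin.
- exact: mJ.
- apply: (measurable_future mX mJ cadlagXJ qh0).
  apply: path_eventI => //; exact: path_event_argmin.
Qed.

Lemma measurable_splitting_event p F B :
  (forall q, past_event X J (q%:R * mesh R p) (F q)) -> path_event B ->
  measurable (splitting_event p F B).
Proof.
move=> pF mB; rewrite splitting_eventE; apply: bigcupT_measurable => q.
exact: measurable_term.
Qed.

(** The pieces over q are disjoint because the argmin is unique. By time homogeneity the future
    contributes the same factor under [P j] at each q, so it leaves the sum. *)
Lemma splitting_event_factor k p F B :
  (forall q, past_event X J (q%:R * mesh R p) (F q)) -> path_event B ->
  (P k (splitting_event p F B) =
   (\sum_(0 <= q <oo) P k ((F q `&` argmin_past p q) `&`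
      [set w | J w (q%:R * mesh R p) = Some j])) *
   P j (whole X J @^-1` (argmin_future p `&` B)))%E.
Proof.
move=> pF mB; rewrite splitting_eventE measure_semi_bigcup//.
- transitivity (\sum_(0 <= q <oo) (P j (whole X J @^-1` (argmin_future p `&` B)) *
    P k ((F q `&` argmin_past p q) `&` [set w | J w (q%:R * mesh R p) = Some j])))%E.
    apply: eq_eseriesr => q _; rewrite muleC; apply: markov_split => //.
    + by rewrite mulr_ge0 ?mesh_ge0.
    + by apply: past_eventI => //; exact: past_event_argmin.
    + by apply: path_eventI => //; exact: path_event_argmin.
  have fB : P j (whole X J @^-1` (argmin_future p `&` B)) \is a fin_num.
    apply: fin_num_measure; apply: (measurable_whole mX mJ).
    by apply: path_eventI => //; exact: path_event_argmin.
  by rewrite -(fineK fB) nneseriesZl// muleC.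
- by move=> q; exact: measurable_term.
- apply/trivIsetP => q q' _ _ qq'; apply/seteqP; split=> w //=.
  move=> [[[[_ pq] Jq] [fq _]] [[[_ pq'] Jq'] [fq' _]]].
  move/eqP: qq'; apply; apply: (@scale_argmin_inj p (X w) (J w)).
    exact/(scale_argminP Jq).
  exact/(scale_argminP Jq').
- apply: bigcupT_measurable => q; exact: measurable_term.
Qed.

(** Each of the four probabilities is a factor of the past times a factor of the future; both sides
    multiply the same four factors. *)
Lemma splitting_event_exchange k p F F' B B' :
  (forall q, past_event X J (q%:R * mesh R p) (F q)) ->
  (forall q, past_event X J (q%:R * mesh R p) (F' q)) ->
  path_event B -> path_event B' ->
  fine (P k (splitting_event p F B)) * fine (P k (splitting_event p F' B')) =
  fine (P k (splitting_event p F B')) * fine (P k (splitting_event p F' B)).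
Proof.
move=> pF pF' mB mB'.
have fV G C : (forall q, past_event X J (q%:R * mesh R p) (G q)) -> path_event C ->
    P k (splitting_event p G C) \is a fin_num.
  by move=> pG mC; apply: fin_num_measure; exact: measurable_splitting_event.
apply: EFin_inj; rewrite !EFinM !fineK ?fV// !splitting_event_factor//.
by rewrite muleACA [X in (_ * X)%E]muleC muleACA.
Qed.

(** Events recovered along the scales, path by path, from the past of the argmin. They are closed
    under finite intersections, which is what Dynkin's lemma asks for. *)
Definition past_limit (F : set Omega) : Prop := measurable F /\
  exists A : scales -> nat -> set Omega,
    (forall p q, past_event X J (q%:R * mesh R p) (A p q)) /\
    (forall w, mortal_path J w ->
      lim_scales [set p | forall q, scale_argmin j p (X w) (J w) q -> A p q w <-> F w]).

Definition future_limit (H : set Omega) : Prop := measurable H /\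
  exists B : scales -> set (obs_path R E),
    (forall p, path_event (B p)) /\
    (forall w, mortal_path J w ->
      lim_scales [set p | forall q, scale_argmin j p (X w) (J w) q ->
        B p (future X J (q%:R * mesh R p) w) <-> H w]).

Lemma past_limitT : past_limit setT.
Proof.
split; first exact: measurableT.
exists (fun _ _ => setT); split=> [p q|w _]; first exact: measurableT.
by apply: (@nearW _ lim_scales).
Qed.

Lemma future_limitT : future_limit setT.
Proof.
split; first exact: measurableT.
exists (fun _ => setT); split=> [p|w _]; last by apply: (@nearW _ lim_scales).
exact: (@measurableT _ (path_space R E)).
Qed.

Lemma past_limitI : setI_closed past_limit.
Proof.
move=> F F' [mF [A [pA AF]]] [mF' [A' [pA' AF']]]; split; first exact: measurableI.
exists (fun p q => A p q `&` A' p q); split=> [p q|w gw].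
  exact: past_eventI.
apply: filterS2 (AF w gw) (AF' w gw) => p AFp AFp' q qmin.
have := AFp q qmin; have := AFp' q qmin; rewrite /setI/=; tauto.
Qed.

Lemma future_limitI : setI_closed future_limit.
Proof.
move=> H H' [mH [B [pB BH]]] [mH' [B' [pB' BH']]]; split; first exact: measurableI.
exists (fun p => B p `&` B' p); split=> [p|w gw].
  exact: path_eventI.
apply: filterS2 (BH w gw) (BH' w gw) => p BHp BHp' q qmin.
have := BHp q qmin; have := BHp' q qmin; rewrite /setI/=; tauto.
Qed.

Lemma future_limitC H : future_limit H -> future_limit (~` H).
Proof.
move=> [mH [B [pB BH]]]; split; first exact: measurableC.
exists (fun p => ~` B p); split=> [p|w gw].
  by apply: (@measurableC _ (path_space R E)); exact: pB.
apply: filterS (BH w gw) => p BHp q qmin.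
have := BHp q qmin; rewrite /setC/=; tauto.
Qed.

(** [Gam] is the conditioning event at G. It is the limit of {J_T = j} intersected with D, where D
    is an event of the post-infimum process separating the two cases of the theorem. *)
Variables (D Gam : set Omega) (k : E).
Hypotheses (mGam : measurable Gam) (limD : future_limit D)
  (DGam : forall w, mortal_path J w -> lim_scales [set p | forall q,
     scale_argmin j p (X w) (J w) q ->
     (J w (q%:R * mesh R p) = Some j /\ D w) <-> Gam w])
  (full : exists N : set Omega,
     [/\ measurable N, P k N = 0%E & forall w, ~ N w -> mortal_path J w]).

Lemma splitting_event_cvg F H A B BD :
  measurable F -> measurable H ->
  (forall p q, past_event X J (q%:R * mesh R p) (A p q)) ->
  (forall p, path_event (B p)) -> (forall p, path_event (BD p)) ->
  (forall w, mortal_path J w -> lim_scales [set p | forall q,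
     scale_argmin j p (X w) (J w) q -> A p q w <-> F w]) ->
  (forall w, mortal_path J w -> lim_scales [set p | forall q,
     scale_argmin j p (X w) (J w) q ->
     B p (future X J (q%:R * mesh R p) w) <-> H w]) ->
  (forall w, mortal_path J w -> lim_scales [set p | forall q,
     scale_argmin j p (X w) (J w) q ->
     BD p (future X J (q%:R * mesh R p) w) <-> D w]) ->
  fine (P k (splitting_event p (A p) (B p `&` BD p))) @[p --> lim_scales] -->
  fine (P k (F `&` (H `&` Gam))).
Proof.
move=> mF mH pA pB pBD AF BH BDD; have [N [mN N0 Ngood]] := full.
apply: (reverse_fatou_cvg (N := N)) => //.
- exact: lim_scales_reverse_fatou.
- move=> p; apply: measurable_splitting_event => //; exact: path_eventI.
- by apply: measurableI => //; exact: measurableI.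
- move=> w /Ngood gw; have [z z0 hz] := gw.
  apply: filterS (filterI (filterI (AF w gw) (BH w gw))
                          (filterI (BDD w gw) (DGam gw))) => p.
  move=> [[AFp BHp] [BDp Gp]]; split.
    move=> [q [qmin Jq /(AFp q qmin) Fw [/(BHp q qmin) Hw /(BDp q qmin) Dw]]].
    by split=> //; split=> //; apply/(Gp q qmin).
  move=> [Fw [Hw Gw]].
  have [q qmin] := scale_argmin_ex (cadlagXJ w) hz z0 j p.
  have [Jq Dw] := (Gp q qmin).2 Gw.
  by exists q; split=> //; [exact/AFp|split; [exact/BHp|exact/BDp]].
Qed.

(** The limit of the exchange identity in which the second pair of events is trivial: F and H
    against the whole space, with D kept on the future side throughout. *)
Lemma splitting_limit F H : past_limit F -> future_limit H ->
  fine (P k (F `&` (H `&` Gam))) * fine (P k Gam) =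
  fine (P k (F `&` Gam)) * fine (P k (H `&` Gam)).
Proof.
move=> [mF [A [pA AF]]] [mH [B [pB BH]]]; have [mD [BD [pBD BDD]]] := limD.
have [_ [T' [pT TT]]] := past_limitT; have [_ [U [pU UT]]] := future_limitT.
have c1 := splitting_event_cvg mF mH pA pB pBD AF BH BDD.
have c2 := splitting_event_cvg measurableT measurableT pT pU pBD TT UT BDD.
have c3 := splitting_event_cvg mF measurableT pA pU pBD AF UT BDD.
have c4 := splitting_event_cvg measurableT mH pT pB pBD TT BH BDD.
rewrite !setTI in c2 c3 c4.
have l := cvgM c1 c2; have r := cvgM c3 c4.
have e : (fun p => fine (P k (splitting_event p (A p) (B p `&` BD p)))) \*
         (fun p => fine (P k (splitting_event p (T' p) (U p `&` BD p)))) =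
         (fun p => fine (P k (splitting_event p (A p) (U p `&` BD p)))) \*
         (fun p => fine (P k (splitting_event p (T' p) (B p `&` BD p)))).
  apply/funext => p; apply: splitting_event_exchange => //; exact: path_eventI.
have F4 : Filter lim_scales by exact: filter_filter.
by rewrite -(cvg_lim _ (l F4))// -(cvg_lim _ (r F4))// e.
Qed.

(** Dynkin's lemma twice: in F for a fixed future limit, then in H for a fixed F of the generated
    sigma-algebra. *)
Lemma splitting_sigma F H : <<s past_limit >> F -> <<s future_limit >> H ->
  [/\ measurable F, measurable H &
  fine (P k (F `&` (H `&` Gam))) * fine (P k Gam) =
  fine (P k (F `&` Gam)) * fine (P k (H `&` Gam))].
Proof.
move=> sF sH.
have step1 H' : future_limit H' -> measurable F /\
    fine (P k (F `&` (H' `&` Gam))) * fine (P k Gam) =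
    fine (P k (F `&` Gam)) * fine (P k (H' `&` Gam)).
  move=> lH'; have mH' : measurable H' by case: lH'.
  have L := @lambda_system_proportional _ _ _ (P k) (H' `&` Gam) Gam
    (fine (P k Gam)) (fine (P k (H' `&` Gam))) (measurableI _ _ mH' mGam) mGam
    (mulrC _ _).
  apply: (lambda_system_subset past_limitI L _ _ sF) => // F' lF'.
  by split; [case: lF'|exact: splitting_limit].
have mF : measurable F by have [] := step1 _ future_limitT.
have L := @lambda_system_proportional _ _ _ (P k) (F `&` Gam) Gam
  (fine (P k Gam)) (fine (P k (F `&` Gam))) (measurableI _ _ mF mGam) mGam
  (mulrC _ _).
have [H' lH'|//|mH e] := lambda_system_subset future_limitI L _ _ sH; last first.
  by split=> //; rewrite setIA (setIC F) -setIA e mulrC.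
have [_ e] := step1 _ lH'; split; first by case: lH'.
by rewrite setIA (setIC H') -setIA e mulrC.
Qed.

End factorization.

(** * The processes before and after the infimum as limits *)

(** The sets B whose preimage agrees on [Gam] with an element of the generated sigma-algebra form a
    sigma-algebra, so coordinate rectangles suffice. Agreement on [Gam] only is what allows the
    value at G itself to be replaced. *)
Lemma path_event_trace (R : realType) (E : finType) (T : pointedType)
    (f : T -> obs_path R E) (G : set (set T)) (Gam : set T) :
  (forall t A i, measurable A -> exists F, <<s G >> F /\
     forall w, Gam w -> (exists2 a, A a & f w t = Some (a, i)) <-> F w) ->
  forall B, path_event B -> exists F, <<s G >> F /\
     forall w, Gam w -> B (f w) <-> F w.
Proof.
move=> Gf B; pose H : set (set (obs_path R E)) := [set B | exists F, <<s G >> F /\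
  forall w, Gam w -> B (f w) <-> F w].
suff : @path_event R E `<=` H by apply.
have mG : <<s G >> = @measurable _ (g_sigma_algebraType G) by [].
apply: smallest_sub; last first.
  by move=> _ [t [A [i [mA ->]]]]; exact: Gf.
split.
- by exists set0; split=> //; rewrite mG; exact: measurable0.
- move=> A [F [GF AF]]; exists (~` F); split; first by rewrite mG; exact: measurableC.
  by move=> w /AF Aw; rewrite setTD /setC/=; tauto.
- move=> A /choice[F AF]; exists (\bigcup_n F n); split.
    by rewrite mG; apply: bigcupT_measurable => n; case: (AF n).
  move=> w Gw; split=> [[n _ An]|[n _ Fn]]; exists n => //.
    by have [_ /(_ w Gw)[+ _]] := AF n; exact.
  by have [_ /(_ w Gw)[_]] := AF n; exact.
Qed.

Section generators.
Context {R : realType} {E : finType} {d : measure_display}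
  {Omega : measurableType d} (P : E -> probability Omega R)
  (X : Omega -> R -> \bar R) (J : Omega -> R -> option E).
Hypothesis hMAP : killed_MAP P X J.
Variable j : E.
Let mX := map_X_meas hMAP.
Let mJ := map_J_meas hMAP.
Let cadlagXJ := map_cadlag hMAP.
Let G w := inf_time (X w) (J w).
Let I w := overall_inf (X w) (J w).

Let mG : measurable_fun setT G.
Proof. exact: measurable_inf_time. Qed.

Let mI : measurable_fun setT I.
Proof. exact: measurable_overall_inf. Qed.

Let mGt (t : R) : measurable_fun setT (fun w => G w + t).
Proof. exact: measurable_funD. Qed.

Let Gt_ge0 (t : R) w : 0 <= t -> 0 <= G w + t.
Proof. by move=> t0; rewrite addr_ge0// inf_time_ge0. Qed.

Lemma past_limit_before (t : R) : past_limit X J j [set w | t < G w].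
Proof.
split; first by apply: measurable_true; exact: measurable_fun_ltr.
exists (fun p q => [set w | t < q%:R * mesh R p - lag R p]); split=> [p q|w [z z0 hz]].
  exact: (@measurable_cst_prop _ (g_sigma_algebra_preimageType _)).
exact: (lim_scales_before (cadlagXJ w) hz z0).
Qed.

Lemma past_limit_coord (t : R) A i : 0 <= t -> measurable A ->
  past_limit X J j [set w | t < G w /\ A (X w t) /\ J w t = i].
Proof.
move=> t0 mA; split.
  apply: measurableI; first by case: (past_limit_before t).
  by apply: measurableI; [rewrite -[X in measurable X]setTI; exact: mX|exact: mJ].
exists (fun p q => [set w | t < q%:R * mesh R p - lag R p /\ A (X w t) /\ J w t = i]).
split=> [p q|w [z z0 hz]].
  have [tq|qt] := ltP t (q%:R * mesh R p - lag R p); last first.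
    rewrite (_ : [set w | _] = set0); first exact: measurable0.
    by apply/seteqP; split=> w //= [].
  rewrite (_ : [set w | _] = [set w | A (X w t) /\ J w t = i]).
    apply: past_event_coord => //; rewrite t0/= ltW// (lt_le_trans tq)//.
    by rewrite gerBl invr_ge0.
  by apply/seteqP; split=> w //= [].
apply: filterS (lim_scales_before (cadlagXJ w) hz z0 j t) => p Hp q qmin.
by have := Hp q qmin; rewrite /= -/(G w); tauto.
Qed.

Lemma past_limit_inf c : past_limit X J j [set w | (c%:E < I w)%E].
Proof.
split; first by apply: measurable_true; exact: measurable_fun_lte.
exists (fun p q => [set w | ((c + lag R p)%:E < X w (q%:R * mesh R p))%E]).
split=> [p q|w [z z0 hz]]; last exact: (lim_scales_inf (cadlagXJ w) hz z0).
apply: measurable_true; apply: measurable_fun_lte => //.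
by apply: past_measurable_path; rewrite lexx mulr_ge0 ?mesh_ge0.
Qed.

Lemma future_limit_phase (t : R) i : 0 <= t ->
  future_limit X J j [set w | J w (G w + t) = i].
Proof.
move=> t0; split; first by apply: measurable_phase_at => // w; exact: Gt_ge0.
exists (fun p => [set f | exists a, f (t + lag R p) = Some (a, i)]).
split=> [p|w [z z0 hz]]; first exact: path_event_phase.
have t0p (p : scales) : 0 <= t + lag R p by rewrite addr_ge0// invr_ge0.
apply: filterS (lim_scales_phase (cadlagXJ w) hz z0 j t0) => p Hp q qmin.
by rewrite /= /G -(Hp q qmin) future_phaseP.
Qed.

Lemma future_limit_increment (t : R) c : 0 <= t ->
  future_limit X J j [set w | (c%:E < X w (G w + t) - I w)%E].
Proof.
move=> t0; split.
  apply: measurable_true; apply: measurable_fun_lte => //.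
  apply: emeasurable_funB => //; apply: measurable_path_at => // w.
  exact: Gt_ge0.
exists (fun p => [set f | exists a i, [/\ `](c + level R p)%:E, +oo[%classic a,
  setT i & f (t + lag R p) = Some (a, i)]]).
split=> [p|w [z z0 hz]]; first by apply: path_event_coord; exact: emeasurable_itv.
apply: filterS (lim_scales_increment (cadlagXJ w) hz z0 j c t0) => p Hp q qmin.
rewrite /= /G /I -(Hp q qmin); split.
  by move=> [a [i [+ _ /observeE[_ -> _]]]]; rewrite in_itv/= andbT.
move=> cX; exists (X w (q%:R * mesh R p + (t + lag R p)) - X w (q%:R * mesh R p))%E.
exists (J w (q%:R * mesh R p + (t + lag R p))); split=> //; first by rewrite in_itv/= cX.
by apply/observeE; rewrite /= in_itv/= addr_ge0// invr_ge0.
Qed.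

Lemma post_trace (Gam : set Omega) B : path_event B -> exists F, <<s future_limit X J j >> F /\
  forall w, Gam w -> B (observe_from (G w) (I w) (X w) (J w)) <-> F w.
Proof.
apply: path_event_trace => t A i mA.
have [t0|t0] := ltP t 0.
  exists set0; split; first exact: (@measurable0 _ (g_sigma_algebraType _)).
  by move=> w _; split=> // -[a _ /observeE[]]; rewrite /= in_itv/= andbT leNgt t0.
exists ([set w | A (X w (G w + t) - I w)%E] `&` [set w | J w (G w + t) = i]).
split; last first.
  move=> w _; split; first by move=> [a Aa /observeE[_ Xt Jt]]; split; rewrite /= ?Xt.
  move=> [At Jt]; exists (X w (G w + t) - I w)%E => //.
  by apply/observeE; rewrite /= in_itv/= t0.
apply: (@measurableI _ (g_sigma_algebraType (future_limit X J j))).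
  have mf : measurable_fun setT ((fun w => X w (G w + t) - I w)%E :
      g_sigma_algebraType (future_limit X J j) -> \bar R).
    apply: measurable_fun_gt => c; apply: sub_sigma_algebra.
    exact: future_limit_increment.
  by have := mf measurableT A mA; rewrite setTI.
by apply: sub_sigma_algebra; exact: future_limit_phase.
Qed.

Lemma pre_open_trace (Gam : set Omega) B : path_event B -> exists F, <<s past_limit X J j >> F /\
  forall w, Gam w -> B (observe `[0, G w[ (X w) (J w)) <-> F w.
Proof.
apply: path_event_trace => t A i mA.
have [t0|t0] := ltP t 0.
  exists set0; split; first exact: (@measurable0 _ (g_sigma_algebraType _)).
  by move=> w _; split=> // -[a _ /observeE[]]; rewrite /= in_itv/= leNgt t0.
exists [set w | t < G w /\ A (X w t) /\ J w t = i]; split.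
  by apply: sub_sigma_algebra; exact: past_limit_coord.
move=> w _; split.
  by move=> [a Aa /observeE[]]; rewrite /= in_itv/= => /andP[_ ?] -> ->.
by move=> [tG [At Jt]]; exists (X w t) => //; apply/observeE; rewrite /= in_itv/= t0.
Qed.

(** The shortened past never reaches the end point t = G. On the conditioning event, however, the
    state there is (infimum, j), the infimum is a limit of values at T, and {t = G} is the
    intersection of the events {t - 1/(n+1) < G} minus {t < G}. *)
Lemma pre_closed_trace B : path_event B -> exists F, <<s past_limit X J j >> F /\
  forall w, [set w | X w (G w) = I w /\ J w (G w) = Some j] w ->
    B (observe `[0, G w] (X w) (J w)) <-> F w.
Proof.
apply: path_event_trace => t A i mA.
have [t0|t0] := ltP t 0.
  exists set0; split; first exact: (@measurable0 _ (g_sigma_algebraType _)).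
  by move=> w _; split=> // -[a _ /observeE[]]; rewrite /= in_itv/= leNgt t0.
exists ([set w | t < G w /\ A (X w t) /\ J w t = i] `|`
  ((([set w | forall n : nat, t - n.+1%:R^-1 < G w] `&` ~` [set w | t < G w])
    `&` [set w | A (I w)]) `&` [set w | i = Some j])).
split.
  have sub F : past_limit X J j F ->
      @measurable _ (g_sigma_algebraType (past_limit X J j)) F.
    exact: sub_sigma_algebra.
  apply: (@measurableU _ (g_sigma_algebraType (past_limit X J j))).
    by apply: sub; exact: past_limit_coord.
  apply: (@measurableI _ (g_sigma_algebraType (past_limit X J j))); last first.
    exact: (@measurable_cst_prop _ (g_sigma_algebraType _)).
  apply: (@measurableI _ (g_sigma_algebraType (past_limit X J j))).
    apply: (@measurableI _ (g_sigma_algebraType (past_limit X J j))).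
      apply: (@measurable_forall _ (g_sigma_algebraType (past_limit X J j))) => n.
      by apply: sub; exact: past_limit_before.
    apply: (@measurableC _ (g_sigma_algebraType (past_limit X J j))).
    by apply: sub; exact: past_limit_before.
  have mf : measurable_fun setT (I : g_sigma_algebraType (past_limit X J j) -> \bar R).
    by apply: measurable_fun_gt => c; apply: sub; exact: past_limit_inf.
  by have := mf measurableT A mA; rewrite setTI.
move=> w [XG JG]; split.
  move=> [a Aa /observeE[]]; rewrite /= in_itv/= => /andP[_].
  rewrite le_eqVlt => /predU1P[tG|tG] Xt Jt; last by left; rewrite Xt.
  right; split; last by rewrite -Jt tG.
  split; last by rewrite -XG -tG Xt.
  split; last by rewrite tG ltxx.
  by move=> n; rewrite -tG gtrBl invr_gt0.
case=> [[tG [At Jt]]|[[[tG nGt] AI] ->]].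
  by exists (X w t) => //; apply/observeE; rewrite /= in_itv/= t0 ltW.
have -> : t = G w.
  apply/eqP; rewrite eq_le andbC; apply/andP; split.
    by rewrite leNgt; apply/negP.
  apply/ler_addgt0Pl => e e0.
  have [n _ /(_ n (leqnn n))/= ne] := near_infty_natSinv_lt (PosNum e0).
  have := tG n; rewrite ltrBlDr => /ltW /le_trans; apply.
  by rewrite addrC lerD2r ltW.
exists (I w) => //; apply/observeE; split => //.
by rewrite /= in_itv/= lexx andbT inf_time_ge0.
Qed.

End generators.

Lemma cindep_split (R : realType) (E : finType) (d : measure_display)
    (Omega : measurableType d) (P : probability Omega R) (Gam : set Omega)
    (Y Z : Omega -> obs_path R E) (G1 G2 : set (set Omega)) :
  (0 < P Gam)%E -> measurable Gam ->
  (forall A, path_event A -> exists F, <<s G1 >> F /\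
     forall w, Gam w -> A (Y w) <-> F w) ->
  (forall B, path_event B -> exists H, <<s G2 >> H /\
     forall w, Gam w -> B (Z w) <-> H w) ->
  (forall F H, <<s G1 >> F -> <<s G2 >> H ->
     fine (P (F `&` (H `&` Gam))) * fine (P Gam) =
     fine (P (F `&` Gam)) * fine (P (H `&` Gam))) ->
  cindep P Gam Y Z.
Proof.
move=> Pgt0 mGam GY GZ GG A B pA pB.
have [F [sF YF]] := GY A pA; have [H [sH ZH]] := GZ B pB.
have P0 : fine (P Gam) != 0 by rewrite fine_eq0 ?gt_eqF// fin_num_measure.
rewrite /cprob.
have -> : (Y @^-1` A `&` Z @^-1` B) `&` Gam = F `&` (H `&` Gam).
  apply/seteqP; split=> w /=.
    by move=> [[/= Aw Bw] Gw]; split; [exact/YF|split=> //; exact/ZH].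
  by move=> [Fw [Hw Gw]]; split=> //; split; [exact/YF|exact/ZH].
have -> : Y @^-1` A `&` Gam = F `&` Gam.
  by apply/seteqP; split=> w /= [? Gw]; split=> //; exact/YF.
have -> : Z @^-1` B `&` Gam = H `&` Gam.
  by apply/seteqP; split=> w /= [? Gw]; split=> //; exact/ZH.
rewrite mulrACA -(GG F H sF sH) -mulrA; congr (_ * _).
by rewrite mulrA divff// mul1r.
Qed.

Theorem proposition3p1 (R : realType) (E : finType) (d : measure_display)
    (Omega : measurableType d) (P : E -> probability Omega R)
    (X : Omega -> R -> \bar R) (J : Omega -> R -> option E) (q : E -> R)
    (hMAP : killed_MAP P X J) (hirr : irreducible_phase P J)
    (hq : killing_rates P J q) (hq0 : exists i : E, q i != 0) :
  let Xinf := fun w => overall_inf (X w) (J w) in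
  let G := fun w => inf_time (X w) (J w) in
  let post := fun w => observe_from (G w) (Xinf w) (X w) (J w) in
  forall k : E,
    (forall j : E,
       let H := [set w | X w (G w) = Xinf w /\ J w (G w) = Some j] in
       (0 < P k H)%E ->
       cindep (P k) H (fun w => observe `[0, G w] (X w) (J w)) post) /\
    (forall j : E,
       let H := [set w | (Xinf w < X w (G w))%E /\
                         left_phase (J w) (G w) = Some j] in
       (0 < P k H)%E ->
       cindep (P k) H (fun w => observe `[0, G w[ (X w) (J w)) post).
Proof.
move=> Xinf G post k.
have mX := map_X_meas hMAP; have mJ := map_J_meas hMAP; have cad := map_cadlag hMAP.
have full := mortal_path_full hMAP hirr hq hq0 k.
have mG : measurable_fun setT G by exact: measurable_inf_time.
have mI : measurable_fun setT Xinf by exact: measurable_overall_inf.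
have G0 w : 0 <= G w by exact: inf_time_ge0.
have mXG : measurable_fun setT (fun w => X w (G w)) by exact: measurable_path_at.
(* The case distinction is read off the post-infimum process at time 0: its initial value is
   positive exactly when X_G exceeds the infimum. *)
have jump j : future_limit X J j [set w | (0 < X w (G w) - Xinf w)%E].
  have := future_limit_increment hMAP j 0 (lexx 0).
  by under [X in future_limit _ _ _ X]eq_set do rewrite addr0.
have jumpP w : (0 < X w (G w) - Xinf w)%E <-> (Xinf w < X w (G w))%E.
  by rewrite sube_gt0.
split=> j H PH.
- have mH : measurable H.
    suff mXI : measurable [set w | X w (G w) = Xinf w].
      by apply: measurableI => //; exact: measurable_phase_at.
    rewrite (_ : [set w | _] = [set w | (X w (G w) <= Xinf w)%E] `&`
      [set w | (Xinf w <= X w (G w))%E]).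
      by apply: measurableI; apply: measurable_true; exact: measurable_fun_lee.
    by apply/seteqP; split=> w /= => [->|[? ?]]; [|apply/eqP; rewrite eq_le; apply/andP].
  apply: (cindep_split PH mH (pre_closed_trace hMAP j) (post_trace hMAP j H)).
  move=> F F' sF sF'.
  (* Here D coincides with the conditioning event. The grid phase J_T may be j for other paths too,
     but D then fails; on D itself the bonus ensures J_T = j. *)
  have limD : future_limit X J j ([set w | J w (G w) = Some j] `&`
      ~` [set w | (0 < X w (G w) - Xinf w)%E]).
    apply: future_limitI; last exact: future_limitC.
    have := future_limit_phase hMAP j (Some j) (lexx 0).
    by under [X in future_limit _ _ _ X]eq_set do rewrite addr0.
  have [|_ _ ->//] := splitting_sigma hMAP mH limD _ full sF sF'.
  move=> w gw; have [z z0 hz] := gw.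
  have [Hw|nHw] := pselect (H w).
    have [XG JG] := Hw.
    apply: filterS (lim_scales_attained_phase (cad w) hz z0 XG JG) => p Jp r rmin.
    split=> // _; split; first exact: Jp.
    by split=> // /jumpP; rewrite XG ltxx.
  apply: (@nearW _ lim_scales) => p r rmin; split=> // -[_ [JG /jumpP nX]].
  exfalso; apply: nHw; split=> //; apply/eqP; rewrite eq_le.
  by rewrite leNgt (introN idP nX) (overall_inf_le (cad w) (G0 w)).
- have mH : measurable H.
    apply: measurableI; last exact: measurable_left_phase.
    by apply: measurable_true; exact: measurable_fun_lte.
  apply: (cindep_split PH mH (pre_open_trace hMAP j H) (post_trace hMAP j H)).
  move=> F F' sF sF'.
  have [|_ _ ->//] := splitting_sigma hMAP mH (jump j) _ full sF sF'.
  move=> w gw; have [z z0 hz] := gw.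
  (* With a jump at G the argmin ends up before G, so J_T is the left phase; without one, D and the
     conditioning event both fail. *)
  have [IX|nIX] := pselect (Xinf w < X w (G w))%E.
    apply: filterS (lim_scales_left_phase (cad w) hz z0 j IX) => p Jp r rmin.
    rewrite (Jp r rmin) /H/=; split=> [[? _]|[_ ?]]; split=> //.
    exact/jumpP.
  apply: (@nearW _ lim_scales) => p r rmin.
  by split=> [[_ /jumpP]|[]].
Qed.
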